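(* Let $\alpha>0$ and let $\lambda\ne0$ be a finite measure on $\mathcal{P}^*_+$ with $c(\lambda):=\int_{\mathcal{P}^*_+}\sum_{k\ge1}x_k^{-\alpha}\lambda(d\mathbf{x})<\infty$, normalized so that $c(\lambda)\Gamma(\alpha)=1$, and let $(\mathbf{Z}_n)_{n\ge0}$ be the associated branching random walk on $\mathbb{R}_+^2$. Let $(S_n)_{n\ge0}$ be a random walk on $\mathbb{R}_+$ started from $0$ whose increments have the gamma distribution with parameter $(\alpha,1)$, that is with density $\Gamma(\alpha)^{-1}x^{\alpha-1}e^{-x}$ for $x>0$. Let $(U_i)_{i\ge1}$ be i.i.d. uniform random variables on $[0,1]$, independent of $(S_n)_{n\geq 0}$, and set $A_n:=U_1\cdots U_n$ for $n\ge1$. Then for every $n\ge1$ and every measurable $f:([0,1]\times\mathbb{R}_+)^n\to\mathbb{R}_+$, $$\mathbb{E}\left(\int_{[0,1]\times\mathbb{R}_+}f\big((1-t_i,x_i)_{i\le n}\big)\,\mathbf{Z}_n(dt,dx)\right)=\mathbb{E}\Big(f\big((A_i,S_i)_{i\le n}\big)\,e^{S_n}\prod_{i=1}^{n-1}A_i\Big),$$ where, for an atom $(t,x)$ of $\mathbf{Z}_n$ with $t\le1$, $(t_i,x_i)$ denotes its ancestor at generation $i$, $1\le i\le n$, with $(t_n,x_n)=(t,x)$.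
   Context: $\mathcal{P}^*_+$ is the space of non-decreasing sequences $\mathbf{x}=(x_k)_{k\ge1}$ in $(0,\infty]$ with $x_1<\infty$ and $\lim_{k\to\infty}x_k=\infty$, with the topology of pointwise convergence; entries equal to $\infty$ are not counted as atoms, and $\infty^{-\alpha}=0$. For $c>0$, $c\mathbf{x}=(cx_k)_{k\ge1}$. Define the measure $\Lambda^*$ on $\mathcal{P}^*_+$ by $\int F(\mathbf{x})\,\Lambda^*(d\mathbf{x})=\int_0^\infty y^{\alpha-1}\int_{\mathcal{P}^*_+}F(y\mathbf{x})\,\lambda(d\mathbf{x})\,dy$ for measurable $F\ge0$. Let $\mathbf{N}$ be a Poisson point process on $(0,\infty)\times\mathcal{P}^*_+$ with intensity $dt\times\Lambda^*(d\mathbf{x})$, and let $\mathbf{Z}_1$ be the point process on $(0,\infty)^2$ obtained by replacing each atom $(t,\mathbf{x})$ of $\mathbf{N}$ by the atoms $(t,x_k)$, $k\ge1$, $x_k<\infty$. The branching random walk $(\mathbf{Z}_n)_{n\ge0}$ on $\mathbb{R}_+^2$ with reproduction law $\mathbf{Z}_1$ is defined by $\mathbf{Z}_0=\delta_{(0,0)}$, and $\mathbf{Z}_{n+1}$ is obtained from $\mathbf{Z}_n$ by replacing each atom $z$ of $\mathbf{Z}_n$ by the point process of its children, which is the translate by $z$ of an independent copy of $\mathbf{Z}_1$. This parent–child relation defines the ancestors of each atom: an atom $(t,x)$ of $\mathbf{Z}_n$ has an ancestor $(t_i,x_i)$ at each generation $i\le n$, with $0<t_1<\dots<t_n=t$ and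 $0<x_1<\dots<x_n=x$. *)

(* Defs.v *)
From HB Require Import structures.
From mathcomp Require Import all_boot all_order all_algebra.
From mathcomp Require Import all_classical all_reals all_analysis.
From mathcomp Require Import measurable_realfun.
Set Implicit Arguments.
Unset Strict Implicit.
Unset Printing Implicit Defensive.
Import Order.TTheory GRing.Theory Num.Theory.
Import numFieldNormedType.Exports.
Local Open Scope classical_set_scope.
Local Open Scope ring_scope.

(* Sequences are indexed from 0 where the mathematics indexes from 1: [x k]    *)
(* stands for x_{k+1} and [U i] for U_{i+1}. Times and generations are not     *)
(* shifted: [S n] is S_n and [uprod U n] is A_n = U_1 ... U_n.                 *)

Section pstar.
Variable R : realType.

Definition pstar_set : set {ptws nat -> \bar R} :=
  [set x | [/\ forall k, (0 < x k)%E,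
               nondecreasing_seq x,
               (x 0%N < +oo)%E
             & x k @[k --> \oo] --> +oo%E]].

Definition pstar : Type := set_type pstar_set.

Definition pstar_val (x : pstar) : nat -> \bar R := set_val x.

(* {ptws _ -> _} is the topology of pointwise convergence; a set_type has the *)
(* topology induced by the ambient space.                                     *)
HB.instance Definition _ := Topological.copy pstar (set_type pstar_set).

Lemma pstar_nat : pstar_set (fun k => (k.+1%:R)%:E).
Proof.
split.
- by move=> k; rewrite lte_fin ltr0n.
- by move=> m n mn; rewrite lee_fin ler_nat ltnS.
- by rewrite ltry.
- apply/cvgeryP; apply/cvgrnyP; apply/cvgnyPge => A; near=> n.
  apply: leqW; near: n; exact: nbhs_infty_ge.
Unshelve. all: by end_near. Qed.

HB.instance Definition _ := isPointed.Build pstar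
  (@exist _ (fun x => x \in pstar_set) _ (mem_set pstar_nat)).

HB.instance Definition _ := @isMeasurable.Build default_measure_display pstar
  <<s @open pstar >> (@sigma_algebra0 _ setT _) (@sigma_algebraC _ _)
  (@sigma_algebra_bigcup _ setT _).

(* Only used for c > 0; when c *: x is not in P*_+ the value is x. *)
Definition pscale (c : R) (x : pstar) : pstar :=
  insubd x (fun k => (c%:E * pstar_val x k)%E).

Lemma pscaleE (c : R) (x : pstar) k : 0 < c ->
  pstar_val (pscale c x) k = (c%:E * pstar_val x k)%E.
Proof.
move=> c0; rewrite /pscale /pstar_val set_valE insubdK //.
case: x => x /= /[1!inE] -[xpos xnd x0 xoo]; rewrite /in_mem /=; apply/asboolP.
split.
- by move=> j; rewrite mule_gt0.
- by move=> m n mn; rewrite lee_pmul2l// xnd.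
- by move: x0 (xpos 0%N); case: (x 0%N) => //= r _ _; rewrite -EFinM ltry.
- by rewrite -(gt0_muley (_ : 0 < c%:E)%E) //; apply: cvgeZl.
Qed.

End pstar.

Section parameters.
Variable R : realType.
Local Notation mu := (@lebesgue_measure R).

Definition Gamma (a : R) : R :=
  \int[mu]_(x in `]0, +oo[) (x `^ (a - 1) * expR (- x)).

Definition gamma_pdf (a x : R) : R :=
  (Gamma a)^-1 * x `^ (a - 1) * expR (- x).

Definition gamma_prob (a : R) (B : set R) : \bar R :=
  (\int[mu]_(x in B `&` `]0%R, +oo[) (gamma_pdf a x)%:E)%E.

(* x^{-a} with the convention oo^{-a} = 0; [poweR] would return +oo there. *)
Definition inv_pow (a : R) (x : \bar R) : \bar R :=
  if x is r%:E then (r `^ (- a))%:E else 0%E.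

Definition c_lambda (a : R) (lam : set (pstar R) -> \bar R) : \bar R :=
  (\int[lam]_x \sum_(0 <= k <oo) inv_pow a (pstar_val x k))%E.

Definition is_Lambda_star (a : R) (lam Lam : set (pstar R) -> \bar R) : Prop :=
  forall F : pstar R -> \bar R,
    measurable_fun setT F -> (forall x, (0 <= F x)%E) ->
    (\int[Lam]_x F x =
     \int[mu]_(y in `]0%R, +oo[)
        ((y `^ (a - 1))%:E * \int[lam]_x F (pscale y x)))%E.

Definition intensity (Lam : set (pstar R) -> \bar R) :
    set (R * pstar R) -> \bar R :=
  product_measure1 (mrestr mu (measurable_itv `]0, +oo[)) Lam.

End parameters.

Section independence.
Context {d : measure_display} {Omega : measurableType d} {R : realType}.
Variable P : probability Omega R.

Definition indep_sigma (I : choiceType) (F : I -> set (set Omega)) : Prop :=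
  forall (J : seq I) (E : I -> set Omega), uniq J ->
    (forall i, i \in J -> F i (E i)) ->
    P (\bigcap_(i in [set` J]) E i) = (\prod_(i <- J) P (E i))%E.

Definition sigma_of (I : Type) d' (T : measurableType d') (X : I -> Omega -> T) :
    set (set Omega) :=
  <<s \bigcup_i preimage_set_system setT (X i) measurable >>.

Definition indep_rv (I : choiceType) d' (T : measurableType d')
    (X : I -> Omega -> T) : Prop :=
  indep_sigma (fun i => preimage_set_system setT (X i) measurable).

(* A point process is given by an enumeration of its atoms: X represents      *)
(* sum_j delta_{X_j}. All the processes considered here have infinite         *)
(* intensity, hence almost surely infinitely many atoms.                      *)
Definition npoints d' (T : measurableType d') (X : nat -> Omega -> T)
    (B : set T) (w : Omega) : \bar R :=
  (\sum_(0 <= j <oo) \d_(X j w) B)%E.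

(* [poisson_pmf] is not used because it is 1 at every k when the rate is 0. *)
Record poisson_process d' (T : measurableType d') (mu : set T -> \bar R)
    (X : nat -> Omega -> T) : Prop := PoissonProcess {
  pp_measurable : forall j, measurable_fun setT (X j);
  pp_law : forall B (m : R), measurable B -> mu B = m%:E -> forall k : nat,
    P [set w | npoints X B w = k%:R%:E] = (m ^+ k / k`!%:R * expR (- m))%:E;
  pp_law_infinite : forall B, measurable B -> mu B = +oo%E ->
    P [set w | npoints X B w = +oo%E] = 1%E;
  pp_indep : forall n (B : 'I_n -> set T),
    (forall i, measurable (B i)) -> trivIset setT B ->
    indep_rv (fun i => npoints X (B i)) }.

End independence.

(* Individuals are coded by words: [::] is the root, and [(j, k) :: u] is the *)
(* child of u associated with the k-th entry of the j-th atom of the Poisson  *)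
(* point process N u, which gives the copy of Z_1 attached to u. The ancestor *)
(* of u at generation i is [drop (size u - i) u]. The atoms of Z_n are the    *)
(* positions of the words in [generation n], counted with multiplicity.       *)
Notation word := (seq (nat * nat)).

Section branching_random_walk.
Variable R : realType.
Context {d : measure_display} {Omega : measurableType d}.

Section genealogy.
Variable N : word -> nat -> Omega -> R * pstar R.

(* Entries equal to +oo are not atoms of Z_1. *)
Fixpoint is_atom (w : Omega) (u : word) : bool :=
  if u is (j, k) :: v
  then is_atom w v && (pstar_val (N v j w).2 k < +oo)%E else true.

Fixpoint position (w : Omega) (u : word) : R * R :=
  if u is (j, k) :: v
  then position w v + ((N v j w).1, fine (pstar_val (N v j w).2 k)) else (0, 0).

Definition generation (n : nat) (w : Omega) : set word :=
  [set u | size u = n /\ is_atom w u].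

Definition ancestor (w : Omega) (u : word) (i : nat) : R * R :=
  position w (drop (size u - i) u).

End genealogy.

Variable P : probability Omega R.

Record is_brw (Lam : set (pstar R) -> \bar R)
    (N : word -> nat -> Omega -> R * pstar R) : Prop := IsBrw {
  brw_poisson : forall u, poisson_process P (intensity Lam) (N u);
  brw_time_gt0 : forall u j w, 0 < (N u j w).1;
  brw_indep : indep_sigma P (fun u => sigma_of (N u)) }.

Record is_gamma_walk (a : R) (S : nat -> Omega -> R) : Prop := IsGammaWalk {
  walk0 : forall w, S 0%N w = 0;
  walk_ge0 : forall n w, 0 <= S n w;
  walk_measurable : forall n, measurable_fun setT (S n);
  walk_law : forall n B, measurable B ->
    P ((fun w => S n.+1 w - S n w) @^-1` B) = gamma_prob a B;
  walk_indep : indep_rv P (fun n w => S n.+1 w - S n w) }.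

Record is_iid_uniform (U : nat -> Omega -> R) : Prop := IsIidUniform {
  unif_itv : forall i w, 0 <= U i w <= 1;
  unif_measurable : forall i, measurable_fun setT (U i);
  unif_law : forall i B, measurable B ->
    P (U i @^-1` B) = uniform_prob (@ltr01 R) B;
  unif_indep : indep_rv P U }.

Definition indep_seqs (S U : nat -> Omega -> R) : Prop :=
  indep_sigma P (fun b : bool => if b then sigma_of S else sigma_of U).

Definition uprod (U : nat -> Omega -> R) (n : nat) (w : Omega) : R :=
  \prod_(i < n) U i w.

End branching_random_walk.

Definition unit_strip (R : realType) : set (R * R) :=
  [set z | 0 <= z.1 <= 1 /\ 0 <= z.2].

Definition unit_strip_pow (R : realType) (n : nat) : set (n.-tuple (R * R)) :=
  [set p | forall i, unit_strip (tnth p i)].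

(* Main.v *)
Require Import Defs.
From HB Require Import structures.
From mathcomp Require Import all_boot all_order all_algebra.
From mathcomp Require Import all_classical all_reals all_analysis.
From mathcomp Require Import measurable_realfun.
From mathcomp Require Import ring.
Set Implicit Arguments.
Unset Strict Implicit.
Unset Printing Implicit Defensive.
Import Order.TTheory GRing.Theory Num.Theory.
Import numFieldNormedType.Exports.
Local Open Scope classical_set_scope.
Local Open Scope ring_scope.

(* Attach to each word of length n its position together with the tuple of   *)
(* the positions of its ancestors. The Poisson process attached to a word is  *)
(* independent of the part of the genealogy that determines this state, so    *)
(* by Campbell's formula one more generation acts on test functions as        *)
(* integration against [ds nu(dx)], where the definition of Lambda^* and      *)
(* [c(lambda) Gamma(alpha) = 1] give                                          *)
(* [nu(dx) = x^(alpha - 1) / Gamma(alpha) dx]. One step of the walk does the  *)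
(* same to [H(..) e^{S_n} A_1 ... A_(n-1)]: the new factor of the exponential *)
(* weight cancels that of the gamma density, and [s = A_n (1 - u)] sends      *)
(* [A_n du] to the Lebesgue measure on [0, A_n], all that is seen by a test   *)
(* function vanishing after time 1. Induction on n concludes.                 *)

(** * Integration *)

(** Both sides obey the same recursion in n. For a test function H of the current point and the
    tuple of past points, [generation_sum] is the mean sum of H over generation n, and [walk_sum] is
    the mean of H along the walk, weighted by e^{S_n} A_1 ... A_(n-1). Passing from n + 1 to n
    replaces H by [kernel a H], its integral over one more displacement (s, x) against ds x^(a-1) /
    Gamma(a) dx on s, x > 0: this is [generation_sumS] and [walk_sumS]. At n = 0 both are the value
    of H at the origin.

    On the branching side, [state_spec] allows the parent to be frozen, and [campbell_children]
    computes the mean measure of Z_1: the scaling variable y of Lambda^* turns each entry x_k into a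
    factor x_k^(-a) ([integral_Lambda_star_atoms]), and the sum of these factors has integral
    c(lambda) = 1 / Gamma(a). On the walk side, [integral_walk_push] undoes the exponential factor
    of the gamma density and the scale A_n of the time step. It sees only times up to 1, so H has to
    vanish after time 1; [kernel] preserves this because time increases along a lineage. The theorem
    is the case where H is f read through t -> 1 - t and cut off after time 1. *)

Section integration.
Local Open Scope ereal_scope.

(** The scalar may be infinite, as the integral multiplying c(lambda) in
    [integral_Lambda_star_atoms] can be. For x = +oo, either all terms are 0 or one positive term
    makes both sides infinite. *)
Lemma ge0_nneseriesZl (R : realType) (u : nat -> \bar R) (x : \bar R) :
  (forall k, 0 <= u k) -> 0 <= x ->
  \sum_(0 <= k <oo) (x * u k) = x * \sum_(0 <= k <oo) u k.
Proof.
move=> u0.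
case: x => [r| |] x0; [exact: nneseriesZl| |by rewrite leeNy_eq in x0].
have [uE|] := pselect (forall k, u k = 0).
  by rewrite !eseries0 ?mule0// => k _ _; rewrite uE ?mule0.
move=> /existsNP[k /eqP uk0].
have uk : 0 < u k by rewrite lt0e uk0 u0.
rewrite [LHS](nneseries_pinfty (k := k)) ?gt0_mulye//; last first.
  by move=> i _; rewrite mule_ge0.
apply: lt_le_trans uk _.
by rewrite (nneseriesD1 (n := k) (fun i _ => u0 i))// leeDl// nneseries_ge0.
Qed.

(** * Integration against a measure with a density *)

Section density.
Import HBNNSimple.
Context d (T : measurableType d) (R : realType).
Variables (m nu : {measure set T -> \bar R}) (h : T -> R).
Hypothesis mh : measurable_fun setT h.
Hypothesis h0 : forall x, (0 <= h x)%R.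
Hypothesis nuE : forall A, measurable A -> nu A = \int[m]_(x in A) (h x)%:E.

Let integral_density_nnsfun (f : {nnsfun T >-> R}) :
  \int[nu]_x (f x)%:E = \int[m]_x ((f x)%:E * (h x)%:E).
Proof.
under [LHS]eq_integral do rewrite fimfunE -fsumEFin//.
rewrite [LHS]ge0_integral_fsum//; last 2 first.
  - by move=> r; exact/measurable_EFinP/measurableT_comp.
  - by move=> n x _; rewrite EFinM nnfun_muleindic_ge0.
under [RHS]eq_integral.
  move=> x xD; rewrite fimfunE -fsumEFin// ge0_mule_fsuml; last first.
    by move=> r; rewrite EFinM nnfun_muleindic_ge0.
  over.
rewrite [RHS]ge0_integral_fsum//; last 2 first.
  - move=> r; apply: emeasurable_funM; last exact/measurable_EFinP.
    by apply/measurable_EFinP; apply/measurableT_comp.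
  - move=> n x _; rewrite mule_ge0//; last by rewrite lee_fin.
    by rewrite EFinM nnfun_muleindic_ge0.
apply: eq_fsbigr => r _.
have mr : measurable (f @^-1` [set r]) by [].
rewrite integralZl_indic_nnsfun// integral_indic// setIT nuE//.
under [RHS]eq_integral do rewrite EFinM -muleA.
have [r0|r0] := leP 0%R r; last first.
  rewrite (_ : f @^-1` [set r] = set0); last by rewrite preimage_nnfun0.
  rewrite integral_set0 mule0 integral0_eq// => x _.
  by rewrite indicE in_set0 mul0e mule0.
rewrite ge0_integralZl_EFin//; last 2 first.
- by move=> x _; rewrite mule_ge0// lee_fin.
- by apply: emeasurable_funM; exact/measurable_EFinP.
congr (_ * _); rewrite integral_mkcond; apply: eq_integral => x _.
by rewrite patchE indicE; case: ifPn => _; rewrite ?mul1e ?mul0e.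
Qed.

(** True for simple functions by linearity; both sides pass to the limit by monotone convergence. *)
Lemma ge0_integral_density (f : T -> \bar R) :
  measurable_fun setT f -> (forall x, 0 <= f x) ->
  \int[nu]_x f x = \int[m]_x (f x * (h x)%:E).
Proof.
move=> mf f0; pose f_ := nnsfun_approx measurableT mf.
have cf x : (f_ n x)%:E @[n --> \oo] --> f x by exact: cvg_nnsfun_approx.
have ndf x : nondecreasing_seq (fun n => (f_ n x)%:E).
  by move=> i j ij; rewrite lee_fin; exact/lefP/nd_nnsfun_approx.
transitivity (limn (fun n => \int[nu]_x (f_ n x)%:E)).
  rewrite -monotone_convergence//.
  - by apply: eq_integral => x _; apply/esym/cvg_lim => //; exact: cf.
  - by move=> n; exact/measurable_EFinP.
  - by move=> n x _; rewrite lee_fin.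
rewrite [X in limn X](_ : _ = (fun n => \int[m]_x ((f_ n x)%:E * (h x)%:E))).
  rewrite -monotone_convergence//.
  - apply: eq_integral => x _; apply/cvg_lim => //.
    by apply: cvgeZr => //; exact: cf.
  - by move=> n; apply: emeasurable_funM; exact/measurable_EFinP.
  - by move=> n x _; rewrite mule_ge0// lee_fin.
  - by move=> x _ i j ij; rewrite lee_wpmul2r ?lee_fin//; exact: ndf.
by apply/funext => n; exact: integral_density_nnsfun.
Qed.

End density.

Definition pushforward_measure d d' (T : measurableType d)
    (T' : measurableType d') (R : realType) (m : {measure set T -> \bar R})
    (f : T -> T') (mf : measurable_fun setT f) : {measure set T' -> \bar R} :=
  measure_function_pushforward__canonical__measure_function_Measure m mf.

(** A restricted measure has density [\1_D]. *)
Lemma ge0_integral_mrestr d (T : measurableType d) (R : realType)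
    (m : {measure set T -> \bar R}) (D : set T) (mD : measurable D)
    (f : T -> \bar R) : measurable_fun setT f -> (forall x, 0 <= f x) ->
  \int[mrestr m mD]_x f x = \int[m]_(x in D) f x.
Proof.
move=> mf f0; rewrite (@ge0_integral_density _ _ _ m _ \1_D)//; last first.
  by move=> A mA; rewrite integral_indic// setIC.
rewrite [RHS]integral_mkcond; apply: eq_integral => x _.
by rewrite patchE indicE; case: ifPn => _; rewrite ?mule1 ?mule0.
Qed.

(* A name for [m] to which a canonical structure can be attached, although     *)
(* finiteness is only known from the proof [h].                                *)
Section finite_copy.
Context d (T : measurableType d) (R : realType).
Variables (m : {measure set T -> \bar R}) (h : fin_num_fun m).

Definition finite_copy of fin_num_fun m : set T -> \bar R := m.

HB.instance Definition _ := Measure.copy (finite_copy h) m.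
HB.instance Definition _ := Measure_isFinite.Build _ _ _ (finite_copy h) h.

End finite_copy.

Section sigma_finite_copy.
Context d (T : measurableType d) (R : realType).
Variables (m : {measure set T -> \bar R}) (h : sigma_finite setT m).

Definition sigma_finite_copy of sigma_finite setT m : set T -> \bar R := m.

HB.instance Definition _ := Measure.copy (sigma_finite_copy h) m.
HB.instance Definition _ :=
  Measure_isSigmaFinite.Build _ _ _ (sigma_finite_copy h) h.

End sigma_finite_copy.

(** * Affine substitution in a Lebesgue integral *)

Section affine.
Context (R : realType).
Local Notation mu := (@lebesgue_measure R).
Variables a b : R.
Hypothesis a0 : (a != 0)%R.
Let phi : measurableTypeR R -> measurableTypeR R := (fun x => a * x + b)%R.

Let mphi : measurable_fun setT phi.
Proof. by apply: measurable_funD => //; exact: measurable_funM. Qed.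

Let aV0 : (0 <= `|a|)%R. Proof. by []. Qed.

(** The two measures agree on the intervals ]l, r], which determine Lebesgue measure. For a < 0 the
    preimage is half-open on the other side, which leaves its length unchanged. *)
Let lebesgue_measure_affine (A : set (measurableTypeR R)) : measurable A ->
  mscale (NngNum aV0) (pushforward_measure mu mphi) A = mu A.
Proof.
move=> mA.
pose m' : {measure set (measurableTypeR R) -> \bar R} :=
  mscale (NngNum aV0) (pushforward_measure mu mphi).
apply/esym; apply: (@lebesgue_measure_unique R m') => //= _ [[l r]] _ <-.
rewrite /mscale /= /pushforward.
have [a_lt0|a_gt0|a_eq0] := ltgtP a 0%R; last by move: a0; rewrite a_eq0 eqxx.
- rewrite (_ : phi @^-1` _ = `[(r - b) / a, (l - b) / a[%classic)%R; last first.
    apply/seteqP; split => x; rewrite /= !in_itv/= /phi => /andP[];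
      by rewrite ler_ndivrMr// ltr_ndivlMr// ltrBlDr lerBrDr (mulrC x)
        => -> ->.
  rewrite !lebesgue_measure_itv/= !lte_fin ltr_nM2r ?invr_lt0// ltrD2r.
  case: ifPn => _; last by rewrite mule0.
  rewrite -!EFinB -EFinM ltr0_norm//; congr (_%:E).
  by field.
- rewrite (_ : phi @^-1` _ = `](l - b) / a, (r - b) / a]%classic)%R; last first.
    apply/seteqP; split => x; rewrite /= !in_itv/= /phi => /andP[];
      by rewrite ler_pdivlMr// ltr_pdivrMr// ltrBlDr lerBrDr (mulrC x)
        => -> ->.
  rewrite !lebesgue_measure_itv/= !lte_fin ltr_pM2r ?invr_gt0// ltrD2r.
  case: ifPn => _; last by rewrite mule0.
  rewrite -!EFinB -EFinM gtr0_norm//; congr (_%:E).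
  by field.
Qed.

Lemma ge0_integral_affine (f : R -> \bar R) :
  measurable_fun setT f -> (forall x, 0 <= f x) ->
  \int[mu]_x f x = `|a|%:E * \int[mu]_x f (a * x + b)%R.
Proof.
move=> mf f0.
pose m' : {measure set (measurableTypeR R) -> \bar R} :=
  mscale (NngNum aV0) (pushforward_measure mu mphi).
rewrite (eq_measure_integral m'); last first.
  by move=> A mA _; apply/esym; exact: lebesgue_measure_affine.
rewrite /m' ge0_integral_mscale//; congr (_ * _).
by rewrite ge0_integral_pushforward//= preimage_setT.
Qed.
End affine.

End integration.

(** * Independence *)

Section independence.
Context {d : measure_display} {Omega : measurableType d} {R : realType}.
Variable P : probability Omega R.

(** These finite intersections, to which [indep_sigma] applies directly, stand in for the
    sigma-algebra generated by the indices off K. *)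
Definition events_off (I : choiceType) (F : I -> set (set Omega)) (K : set I) :
    set (set Omega) :=
  [set D | exists (J : seq I) (E : I -> set Omega),
     [/\ uniq J, forall i, i \in J -> ~ K i, forall i, i \in J -> F i (E i)
       & D = \bigcap_(i in [set` J]) E i]].

(* Events in [C] are independent of [X] seen on the event [E] only: the state  *)
(* of a word is only meaningful where that word is an atom.                    *)
Definition indep_of d' (T : measurableType d') (C : set (set Omega))
    (E : set Omega) (X : Omega -> T) :=
  forall D A, C D -> measurable A ->
    (P (D `&` (X @^-1` A `&` E)) = P D * P (X @^-1` A `&` E))%E.

(** * Independence and Tonelli for a pair of variables *)

Section pair.
Context d1 d2 (T1 : measurableType d1) (T2 : measurableType d2).
Variables (X : Omega -> T1) (Y : Omega -> T2).
Hypotheses (mX : measurable_fun setT X) (mY : measurable_fun setT Y).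

Let XY w := (X w, Y w).
Let mXY : measurable_fun setT XY. Proof. exact: measurable_fun_pair. Qed.

(** For fixed D both sides are finite measures in the target set, so it is enough that they agree on
    rectangles, a generating pi-system. *)
Lemma indep_of_pair (C : set (set Omega)) (E : set Omega) :
  C `<=` measurable -> measurable E ->
  (forall D A B, C D -> measurable A -> measurable B ->
    P (D `&` ((X @^-1` A `&` Y @^-1` B) `&` E)) =
    (P D * P ((X @^-1` A `&` Y @^-1` B) `&` E))%E) ->
  indep_of C E XY.
Proof.
move=> mC mE XYE D A CD mA; have mD := mC _ CD.
have mDE : measurable (D `&` E) by exact: measurableI.
have pD0 : (0 <= fine (P D))%R by rewrite fine_ge0.
pose m1 : {measure set (T1 * T2) -> \bar R} :=
  pushforward_measure (mrestr P mDE) mXY.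
pose m2 : {measure set (T1 * T2) -> \bar R} :=
  mscale (NngNum pD0) (pushforward_measure (mrestr P mE) mXY).
have PDE : (fine (P D))%:E = P D by rewrite fineK// fin_num_measure.
have m1E B : m1 B = P (D `&` (XY @^-1` B `&` E)).
  by rewrite /m1 /= /pushforward /mrestr setICA.
have m2E B : m2 B = (P D * P (XY @^-1` B `&` E))%E.
  by rewrite /m2 /= /mscale /= PDE.
rewrite -m1E -m2E.
pose G : set (set (T1 * T2)) :=
  [set A `*` B | A in measurable & B in measurable].
apply: (measure_unique G (fun=> setT)) => //.
- by rewrite measurable_prod_measurableType.
- move=> _ _ [A1 mA1 [A2 mA2 <-]] [B1 mB1 [B2 mB2 <-]]; rewrite -setXI.
  by exists (A1 `&` B1); [exact: measurableI|exists (A2 `&` B2);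
    [exact: measurableI|]].
- by move=> _; exists setT => //; exists setT => //; rewrite setXTT.
- by rewrite bigcup_const//; exists 0%N.
- move=> _ [A1 mA1 [A2 mA2 <-]]; rewrite m1E m2E.
  by rewrite -(XYE D A1 A2).
- by move=> _; rewrite m1E ltey_eq fin_num_measure//; apply: measurableI => //;
    apply: measurableI => //; rewrite -[_ @^-1` _]setTI; exact: mXY.
Qed.

(** On E the law of (X, Y) is the product of the law of X restricted to E and the law of Y; Tonelli
    concludes. *)
Lemma ge0_integral_indep_pair (E : set Omega) (g : T1 * T2 -> \bar R) :
  measurable E -> measurable_fun setT g -> (forall z, 0 <= g z)%E ->
  (forall A B, measurable A -> measurable B ->
    P ((X @^-1` A `&` Y @^-1` B) `&` E) =
    (P (X @^-1` A `&` E) * P (Y @^-1` B))%E) ->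
  (\int[P]_(w in E) g (X w, Y w) =
   \int[P]_(w in E) \int[P]_w' g (X w, Y w'))%E.
Proof.
move=> mE mg g0 XYE.
have finX : fin_num_fun (pushforward_measure (mrestr P mE) mX).
  move=> A mA; rewrite /= /pushforward /mrestr fin_num_measure//.
  by apply: measurableI => //; rewrite -[_ @^-1` _]setTI; exact: mX.
have finY : fin_num_fun (pushforward_measure P mY).
  move=> A mA; rewrite /= /pushforward fin_num_measure//.
  by rewrite -[_ @^-1` _]setTI; exact: mY.
pose m1 := finite_copy finX; pose m2 := finite_copy finY.
pose m12 : {measure set (T1 * T2) -> \bar R} :=
  pushforward_measure (mrestr P mE) mXY.
transitivity (\int[m12]_z g z)%E.
  rewrite ge0_integral_pushforward// preimage_setT ge0_integral_mrestr//.
    exact: measurableT_comp.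
  by move=> w; exact: g0.
transitivity (\int[(m1 \x m2)%E]_z g z)%E.
  apply: eq_measure_integral => A mA _; apply/esym.
  by apply: product_measure_unique => // A1 A2 mA1 mA2; exact: XYE.
rewrite fubini_tonelli1//.
have mF : measurable_fun setT (fubini_F m2 g).
  exact: measurable_fun_fubini_tonelli_F.
have F0 x : (0 <= fubini_F m2 g x)%E by apply: integral_ge0.
rewrite ge0_integral_pushforward// preimage_setT.
rewrite ge0_integral_mrestr//; last first.
- by move=> w; exact: F0.
- exact: measurableT_comp.
apply: eq_integral => w _; rewrite /= /fubini_F ge0_integral_pushforward//.
by apply: measurableT_comp => //; exact: measurable_fun_pair.
Qed.

End pair.

(** * Using up one more independent index *)

Section step.
Context (I : choiceType) (F : I -> set (set Omega)).
Hypothesis mF : forall i, F i `<=` measurable.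
Hypothesis indF : indep_sigma P F.

Lemma events_off_measurable K : events_off F K `<=` measurable.
Proof.
move=> _ [J [E [uJ JK JF ->]]]; rewrite bigcap_seq big_seq.
by apply: bigsetI_measurable => i /JF /mF.
Qed.

Lemma events_offS K K' : K `<=` K' -> events_off F K' `<=` events_off F K.
Proof.
move=> KK' _ [J [E [uJ JK JF ->]]]; exists J, E.
by split => // i /JK /[swap] /KK'.
Qed.

Lemma events_offT K : events_off F K setT.
Proof.
by exists [::], (fun=> setT); split => //; rewrite set_nil bigcap_set0.
Qed.

(** Adding i to the list that defines D keeps it duplicate-free and off K, and independence over the
    longer list splits off the factor of i. *)
Lemma events_offI (K : set I) i D B : ~ K i -> F i B ->
    events_off F (K `|` [set i]) D ->
  events_off F K (D `&` B) /\ P (D `&` B) = (P D * P B)%E.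
Proof.
move=> Ki FB [J [E [uJ JK JF ->]]].
have iJ : i \notin J by apply/negP => /JK; apply; right.
pose E' j := if j == i then B else E j.
have E'E j : j \in J -> E' j = E j.
  by rewrite /E'; case: eqVneq => // -> ij; rewrite ij in iJ.
have E'i : E' i = B by rewrite /E' eqxx.
have DBE : \bigcap_(j in [set` J]) E j `&` B =
    \bigcap_(j in [set` i :: J]) E' j.
  rewrite !bigcap_seq big_cons setIC E'i; congr (_ `&` _).
  by apply: eq_big_seq => j /E'E ->.
have E'F j : j \in i :: J -> F j (E' j).
  rewrite inE => /predU1P[->|jJ]; first by rewrite E'i.
  by rewrite E'E//; exact: JF.
have uiJ : uniq (i :: J) by rewrite /= iJ.
split.
  rewrite DBE; exists (i :: J), E'; split => // j.
  by rewrite inE => /predU1P[->//|/JK jK Kj]; apply: jK; left.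
rewrite DBE !indF// big_cons muleC E'i; congr (_ * _)%E.
by apply: eq_big_seq => j /E'E ->.
Qed.

Context d1 d2 (T1 : measurableType d1) (T2 : measurableType d2).
Variables (X : Omega -> T1) (Y : Omega -> T2).
Hypotheses (mX : measurable_fun setT X) (mY : measurable_fun setT Y).
Variables (K : set I) (i : I) (E : set Omega).
Hypothesis Ki : ~ K i.
Hypothesis mE : measurable E.
Hypothesis YF : forall B, measurable B -> F i (Y @^-1` B).
Hypothesis indX : indep_of (events_off F K) E X.

Lemma indep_of_next A B : measurable A -> measurable B ->
  P ((X @^-1` A `&` Y @^-1` B) `&` E) =
  (P (X @^-1` A `&` E) * P (Y @^-1` B))%E.
Proof.
move=> mA mB; rewrite setIAC setIC indX// 1?muleC//.
rewrite -[_ @^-1` _]setTI.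
by have [] := events_offI Ki (YF mB) (events_offT _).
Qed.

Lemma ge0_integral_indep_next (g : T1 * T2 -> \bar R) :
  measurable_fun setT g -> (forall z, 0 <= g z)%E ->
  (\int[P]_(w in E) g (X w, Y w) =
   \int[P]_(w in E) \int[P]_w' g (X w, Y w'))%E.
Proof.
by move=> mg g0; apply: ge0_integral_indep_pair => //; exact: indep_of_next.
Qed.

(** The induction step of [state_spec] and [walk_state_spec]: once Y is absorbed, index i is spent.
    An event of Y meets D in an event still off K, of which X is independent. *)
Lemma indep_of_next_pair :
  indep_of (events_off F (K `|` [set i])) E (fun w => (X w, Y w)).
Proof.
apply: indep_of_pair => //; first exact: events_off_measurable.
move=> D A B CD mA mB; have [DB PDB] := events_offI Ki (YF mB) CD.
rewrite indep_of_next// [X in D `&` X]setIAC (setIC _ (Y @^-1` B)) setIA.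
by rewrite indX// PDB -muleA; congr (_ * _)%E; rewrite muleC.
Qed.

End step.

(** The event E can be cut down by a condition on X, since that condition is absorbed in the set
    tested on X. For words, the condition is that the chosen entry is finite. *)
Lemma indep_of_comp d1 d2 (T1 : measurableType d1) (T2 : measurableType d2)
    (C C' : set (set Omega)) (E : set Omega) (X : Omega -> T1) (A0 : set T1)
    (phi : T1 -> T2) :
  C' `<=` C -> measurable A0 -> measurable_fun setT phi ->
  indep_of C E X -> indep_of C' (X @^-1` A0 `&` E) (phi \o X).
Proof.
move=> CC mA0 mphi indX D A /CC CD mA.
have mA' : measurable (phi @^-1` A `&` A0).
  by apply: measurableI => //; rewrite -[_ @^-1` _]setTI; exact: mphi.
by have := indX _ _ CD mA'; rewrite preimage_setI -setIA.
Qed.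

End independence.

(** * Campbell's formula *)

Section campbell.
Context {d : measure_display} {Omega : measurableType d} {R : realType}.
Variable P : probability Omega R.
Context d' (T : measurableType d').
Local Open Scope ereal_scope.

Lemma poisson_mass (m : R) : (0 <= m)%R ->
  \sum_(0 <= k <oo) (m ^+ k / k`!%:R * expR (- m))%:E = 1.
Proof.
move=> m0; transitivity ((expR (- m))%:E * (expR m)%:E); last first.
  by rewrite -EFinM expRN mulVf ?gt_eqF ?expR_gt0.
under eq_eseriesr do rewrite mulrC EFinM.
rewrite nneseriesZl/=; last first.
  by move=> n _; rewrite lee_fin divr_ge0// exprn_ge0.
congr *%E; rewrite /expR -EFin_lim; last exact: is_cvg_series_exp_coeff.
by apply/congr_lim/funext => n /=; rewrite /series/= -sumEFin.
Qed.

Lemma poisson_mean (m : R) : (0 <= m)%R ->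
  \sum_(0 <= k <oo) (k%:R%:E * (m ^+ k / k`!%:R * expR (- m))%:E) = m%:E.
Proof.
move=> m0; have p0 k : 0 <= (m ^+ k / k`!%:R * expR (- m))%:E.
  by rewrite lee_fin mulr_ge0 ?expR_ge0// divr_ge0// exprn_ge0.
rewrite nneseries_recl//; last by move=> k _; rewrite mule_ge0// lee_fin.
rewrite mul0e add0e -(nneseries_addn 1); last first.
  by move=> k; rewrite mule_ge0// lee_fin.
under eq_eseriesr => k _.
  have -> : (k + 1)%:R%:E * (m ^+ (k + 1) / (k + 1)`!%:R * expR (- m))%:E =
      m%:E * (m ^+ k / k`!%:R * expR (- m))%:E.
    rewrite -!EFinM addn1 factS exprS natrM; congr (_%:E).
    have k1 : (k.+1%:R != 0 :> R)%R by rewrite pnatr_eq0.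
    have kf : (k`!%:R != 0 :> R)%R by rewrite pnatr_eq0 -lt0n fact_gt0.
    move: (k.+1%:R) k1 (k`!%:R) kf => a a0 b b0.
    by field; rewrite a0 b0.
  over.
by rewrite nneseriesZl// poisson_mass// mule1.
Qed.

Lemma measurable_npoints (X : nat -> Omega -> T) (B : set T) :
  (forall j, measurable_fun setT (X j)) -> measurable B ->
  measurable_fun setT (@npoints _ _ R _ T X B).
Proof.
move=> mX mB; apply: ge0_emeasurable_sum => [j w _ _|j _].
  by rewrite diracE lee_fin.
rewrite (_ : (fun w => _) = fun w => (\1_B (X j w))%:E); last first.
  by apply/funext => w; rewrite diracE indicE.
by apply/measurable_EFinP; apply: measurableT_comp.
Qed.

(** When m B is finite the Poisson masses add up to 1, so the count is almost surely a finite
    integer and its mean is summed over its level sets. When m B is infinite the count is almost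
    surely infinite. *)
Lemma expectation_npoints (m : set T -> \bar R) X B :
  poisson_process P m X -> measurable B -> 0 <= m B ->
  \int[P]_w npoints X B w = m B.
Proof.
move=> ppX mB; have mX := pp_measurable ppX.
have mN := measurable_npoints mX mB.
have mNE (x : \bar R) : measurable [set w | npoints X B w = x].
  rewrite -[X in measurable X]setTI.
  by apply: (mN measurableT [set x]); exact: emeasurable_set1.
have N0 w : 0 <= npoints X B w :> \bar R by apply: nneseries_ge0.
move mBE : (m B) => v.
case: v mBE => [r| |] mBE; [|move=> _|by rewrite leeNy_eq]; last first.
  apply/eqP; rewrite -leye_eq.
  have PN := pp_law_infinite ppX mB mBE.
  rewrite -(mule1 +oo) -PN -integral_cst//.
  rewrite (@eq_integral _ _ _ _ _ (npoints X B)); last first.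
    by move=> w; rewrite inE => ->.
  exact: ge0_subset_integral.
rewrite lee_fin => r0; have PN := pp_law ppX mB mBE.
pose A k := [set w | npoints X B w = k%:R%:E :> \bar R].
have tA : trivIset setT A.
  apply/trivIsetP => i j _ _ ij; apply/seteqP; split => // w [].
  rewrite /A /= => -> -[] /eqP; rewrite eqr_nat.
  by rewrite (negbTE ij).
have mA k : measurable (A k) by exact: mNE.
have mUA : measurable (\bigcup_k A k) by exact: bigcup_measurable.
have PUA : P (\bigcup_k A k) = 1.
  rewrite measure_bigcup//= -(poisson_mass r0).
  rewrite (@eq_eseriesl _ _ xpredT) => [|k]; last by rewrite in_setT.
  by apply: eq_eseriesr => k _; exact: PN.
have PCUA : P (~` \bigcup_k A k) = 0.
  by have := probability_setC P mUA; rewrite PUA subee.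
rewrite (@ge0_negligible_integral _ _ _ _ _ (~` \bigcup_k A k))//; last first.
  exact: measurableC.
rewrite setTD setCK ge0_integral_bigcup//; last exact: measurable_funTS.
rewrite -(poisson_mean r0); apply: eq_eseriesr => k _.
rewrite (@eq_integral _ _ _ _ _ (cst k%:R%:E)); last first.
  by move=> w; rewrite inE.
by rewrite integral_cst//; congr (_ * _); exact: PN.
Qed.

(** Expected counts identify m with the sum over j of the laws of [X j], and integration against a
    series of measures is termwise. The intensity [m0] is a bare set function, hence its replacement
    by a measure m. *)
Lemma campbell (m0 : set T -> \bar R) (m : {measure set T -> \bar R}) X
    (g : T -> \bar R) :
  poisson_process P m0 X -> (forall A, measurable A -> m0 A = m A) ->
  measurable_fun setT g -> (forall x, 0 <= g x) ->
  \sum_(0 <= j <oo) \int[P]_w g (X j w) = \int[m]_x g x.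
Proof.
move=> ppX m0E mg g0; have mX := pp_measurable ppX.
pose mu_ j : {measure set T -> \bar R} := pushforward_measure P (mX j).
rewrite (eq_measure_integral (mseries mu_ 0)); last first.
  move=> A mA _; rewrite -m0E// -(expectation_npoints ppX mA); last first.
    by rewrite m0E.
  rewrite /npoints.
  rewrite integral_nneseries//.
  - rewrite /mseries; apply: eq_eseriesr => j _ /=; rewrite /pushforward.
    rewrite -[X in P X]setIT -integral_indic//.
    by rewrite -[_ @^-1` _]setTI; exact: (mX j).
  - move=> j; rewrite (_ : (fun w => _) = fun w => (\1_A (X j w))%:E).
      by apply/measurable_EFinP; apply: measurableT_comp.
    by apply/funext => w; rewrite diracE indicE.
rewrite ge0_integral_measure_series//; apply: eq_eseriesr => j _.
by rewrite ge0_integral_pushforward// preimage_setT.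
Qed.

End campbell.

(** * The measure Lambda^* *)

Section lambda_star.
Variable R : realType.
Local Notation mu := (@lebesgue_measure R).
Local Open Scope ereal_scope.

(** Coordinates are continuous for pointwise convergence, so they pull open rays back to open, hence
    Borel, sets. *)
Lemma measurable_coord k :
  measurable_fun setT (fun x : pstar R => pstar_val x k).
Proof.
apply: (measurability _ (ErealGenOInfty.measurableE R)) => _ [_ [r ->] <-].
rewrite setTI; apply: sub_sigma_algebra.
(* This interval has no upper bound, so it contains the point +oo. *)
rewrite (_ : `]r%:E, +oo[%classic = [set y | r%:E < y]); last first.
  by apply/seteqP; split => y; rewrite /= in_itv/= andbT.
have -> : (fun x : pstar R => pstar_val x k) =
    (fun x : {ptws nat -> \bar R} => x k) \o (set_val : pstar R -> _) by [].
apply: open_comp; last exact: open_ereal_gt_ereal.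
move=> x _; apply: continuous_comp; first exact: initial_continuous.
exact: (@proj_continuous nat (fun=> \bar R) k).
Qed.

Lemma pstar_gt0 (x : pstar R) k : 0 < pstar_val x k.
Proof.
by rewrite /pstar_val set_valE; case: x => x /=; rewrite inE => -[].
Qed.

Lemma pstar0_lty (x : pstar R) : pstar_val x 0%N < +oo.
Proof.
by rewrite /pstar_val set_valE; case: x => x /=; rewrite inE => -[].
Qed.

(* Infinite entries of a sequence are not atoms, hence contribute 0. *)
Definition on_fin (g : R -> \bar R) (y : \bar R) : \bar R :=
  if y < +oo then g (fine y) else 0.

Lemma on_fin_ge0 g y : (forall r, 0 <= g r) -> 0 <= on_fin g y.
Proof. by move=> g0; rewrite /on_fin; case: ifP. Qed.

Lemma measurable_on_fin d (T : measurableType d) (h : T * R -> \bar R)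
    (y : T -> \bar R) :
  measurable_fun setT h -> measurable_fun setT y ->
  measurable_fun setT (fun t => on_fin (fun r => h (t, r)) (y t)).
Proof.
move=> mh my; apply: measurable_fun_ifT => //.
- exact: measurable_fun_lte.
- apply: (measurableT_comp mh); apply: measurable_fun_pair => //.
  exact: measurableT_comp.
Qed.

Lemma mem_itv0y (y : R) : (y \in `]0%R, +oo[%classic) = (0 < y)%R.
Proof. by rewrite mem_setE in_itv/= andbT. Qed.

(** Extension by 0 makes half-line integrals into integrals over R, to which [ge0_integral_affine]
    applies. *)
Definition pow_density (a y : R) : R := (y `^ (a - 1) * \1_(`]0, +oo[) y)%R.

Lemma pow_densityE a y :
  pow_density a y = if (0 < y)%R then (y `^ (a - 1))%R else 0%R.
Proof.
rewrite /pow_density indicE mem_itv0y.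
by case: ifP; rewrite ?mulr1 ?mulr0.
Qed.

Lemma measurable_pow_density a : measurable_fun setT (pow_density a).
Proof. by apply: measurable_funM => //; exact: measurable_powR. Qed.

Lemma pow_density_ge0 a y : (0 <= pow_density a y)%R.
Proof. by rewrite mulr_ge0// powR_ge0. Qed.

Lemma integral_pow_density a (g : R -> \bar R) :
  \int[mu]_(y in `]0%R, +oo[) ((y `^ (a - 1))%:E * g y) =
  \int[mu]_y ((pow_density a y)%:E * g y).
Proof.
rewrite integral_mkcond; apply: eq_integral => y _.
rewrite patchE /pow_density indicE; case: ifPn => _; rewrite ?mulr1//.
by rewrite mulr0 mul0e.
Qed.

(** Substituting r y for y on the right brings a factor r, and r^(-a) r (r y)^(a-1) = y^(a-1). *)
Lemma integral_pow_density_scale a (g : R -> \bar R) (r : R) : (0 < r)%R ->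
  measurable_fun setT g -> (forall y, 0 <= g y) ->
  \int[mu]_y ((pow_density a y)%:E * g (y * r)%R) =
  (r `^ (- a))%:E * \int[mu]_y ((pow_density a y)%:E * g y).
Proof.
move=> r0 mg g0.
have mpg : measurable_fun setT (fun y => (pow_density a y)%:E * g y).
  apply: emeasurable_funM => //; apply/measurable_EFinP.
  exact: measurable_pow_density.
have mpgr := measurableT_comp mpg (mulrl_measurable r : measurable_fun setT _).
rewrite [in RHS](@ge0_integral_affine _ r 0)//; last 2 first.
- by rewrite gt_eqF.
- by move=> y; rewrite mule_ge0// lee_fin pow_density_ge0.
under [in RHS]eq_integral do rewrite addr0.
rewrite gtr0_norm// -ge0_integralZl//; last 2 first.
- by move=> y _; rewrite mule_ge0// lee_fin pow_density_ge0.
- by rewrite lee_fin ltW.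
rewrite -ge0_integralZl//; last 3 first.
- exact: emeasurable_funM.
- by move=> y _; rewrite !mule_ge0// lee_fin ?pow_density_ge0// ltW.
- by rewrite lee_fin powR_ge0.
apply: eq_integral => y _; rewrite [in RHS]mulrC !muleA; congr (_ * _).
rewrite -!EFinM; congr (_%:E); rewrite !pow_densityE pmulr_lgt0//.
have [y0|y0] := ltP 0%R y; last by rewrite mulr0.
rewrite (powRM _ (ltW y0) (ltW r0)) (mulrC (y `^ _)%R) mulrA -[LHS]mul1r.
congr (_ * _)%R; rewrite -{2}(powRr1 (ltW r0)).
rewrite -!powRD ?(gt_eqF r0) ?implybT//.
by rewrite (_ : (- a + 1 + (a - 1) = 0)%R) ?powRr0//; ring.
Qed.

(** The density of the mean measure of Z_1, by [campbell_children]. *)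
Definition rate (a s x : R) : R :=
  (\1_(`]0, +oo[) s * ((Gamma a)^-1 * pow_density a x))%R.

Lemma rate_ge0 a s x : (0 <= (Gamma a)^-1)%R -> (0 <= rate a s x)%R.
Proof. by move=> ?; rewrite mulr_ge0// mulr_ge0 ?pow_density_ge0. Qed.

Lemma measurable_rate a :
  measurable_fun setT (fun z : R * R => rate a z.1 z.2).
Proof.
apply: measurable_funM; first exact: measurableT_comp.
apply: measurable_funM => //.
exact: (measurableT_comp (measurable_pow_density a)).
Qed.

Section fix_lambda.
Variables (a : R) (lam : {finite_measure set (pstar R) -> \bar R}).
Variable Lam : {measure set (pstar R) -> \bar R}.
Hypothesis LamE : is_Lambda_star a lam Lam.

Lemma c_lambda_ge0 : 0 <= c_lambda a lam.
Proof.
apply: integral_ge0 => x _; apply: nneseries_ge0 => k _ _.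
by rewrite /inv_pow; case: pstar_val => // r; rewrite lee_fin powR_ge0.
Qed.

(** Under Lambda^* the k-th entry is y x_k with y weighted by y^(a-1). After Tonelli, scaling pulls
    x_k^(-a) out of the integral over y, and these factors add up to c(lambda). *)
Lemma integral_Lambda_star_atoms (g : R -> \bar R) :
  measurable_fun setT g -> (forall y, 0 <= g y) ->
  \sum_(0 <= k <oo) \int[Lam]_x on_fin g (pstar_val x k) =
  c_lambda a lam * \int[mu]_y ((pow_density a y)%:E * g y).
Proof.
move=> mg g0; set G := \int[mu]_y _.
have minv k :
    measurable_fun setT (fun x : pstar R => inv_pow a (pstar_val x k)).
  rewrite (_ : (fun x => _) = fun x : pstar R =>
    on_fin (fun r => (r `^ (- a))%:E) (pstar_val x k)).
    apply: (@measurable_on_fin _ _ (fun z => (z.2 `^ (- a))%:E)).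
      apply/measurable_EFinP.
      exact: (measurableT_comp (measurable_powR (- a)) measurable_snd).
    exact: measurable_coord.
  apply/funext => x; rewrite /inv_pow /on_fin.
  by move: (pstar_gt0 x k); case: (pstar_val x k) => [r| |]//=; rewrite ltry.
have inv0 k (x : pstar R) : 0 <= inv_pow a (pstar_val x k).
  by rewrite /inv_pow; case: pstar_val => // r; rewrite lee_fin powR_ge0.
have G0 : 0 <= G.
  by apply: integral_ge0 => y _; rewrite mule_ge0// lee_fin pow_density_ge0.
rewrite /c_lambda integral_nneseries// muleC -ge0_nneseriesZl//; last first.
  by move=> k; exact: integral_ge0.
apply: eq_eseriesr => k _; rewrite LamE; last 2 first.
- apply: (@measurable_on_fin _ _ (g \o snd)); last exact: measurable_coord.
  exact: measurableT_comp.
- by move=> x; exact: on_fin_ge0.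
rewrite integral_pow_density -ge0_integralZl//.
pose h (z : R * pstar R) :=
  (pow_density a z.1)%:E * on_fin g (z.1%:E * pstar_val z.2 k).
have mh : measurable_fun setT h.
  apply: emeasurable_funM.
    by apply/measurable_EFinP;
      apply: (measurableT_comp (measurable_pow_density a)).
  apply: (@measurable_on_fin _ _ (g \o snd)); first exact: measurableT_comp.
  apply: emeasurable_funM; first exact/measurable_EFinP.
  by apply: (measurableT_comp (measurable_coord k)).
have h0 z : 0 <= h z.
  by rewrite mule_ge0 ?on_fin_ge0// lee_fin pow_density_ge0.
transitivity (\int[mu]_y \int[lam]_x h (y, x)).
  apply: eq_integral => y _.
  (* For y <= 0 the value of [pscale] is only a default, and the density is 0. *)
  have [y0|y0] := ltP 0%R y; last first.
    have py : pow_density a y = 0%R by rewrite pow_densityE ltNge y0.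
    by rewrite py mul0e integral0_eq// => x _; rewrite /h /= py mul0e.
  rewrite -ge0_integralZl//; last 3 first.
  - apply: (@measurable_on_fin _ _ (g \o snd)); first exact: measurableT_comp.
    under eq_fun do rewrite pscaleE//.
    by apply: emeasurable_funM => //; exact: measurable_coord.
  - by move=> x _; exact: on_fin_ge0.
  - by rewrite lee_fin pow_density_ge0.
  by apply: eq_integral => x _; rewrite pscaleE.
rewrite fubini_tonelli//; apply: eq_integral => x _; rewrite /h /=.
(* An infinite entry stays infinite under scaling by y > 0; it contributes 0, in accordance with
   oo^(-a) = 0. *)
have := pstar_gt0 x k; case: (pstar_val x k) => [r| |]//; last first.
  move=> _; rewrite mule0 integral0_eq// => y _.
  have [y0|y0] := ltP 0%R y; last first.
    by rewrite pow_densityE ltNge y0 mul0e.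
  by rewrite gt0_muley ?lte_fin// /on_fin ltxx mule0.
rewrite lte_fin => r0; rewrite muleC -integral_pow_density_scale//.
by apply: eq_integral => y _; rewrite -EFinM /on_fin ltry.
Qed.

Hypothesis c_fin : c_lambda a lam < +oo.

(** The sets where both x_1 and x_1^(a-1) are at most n exhaust the space. The mass of such a set is
    at most the mean number of finite entries y with y and y^(a-1) at most n, which is at most
    c(lambda) n^2 by [integral_Lambda_star_atoms]. *)
Lemma Lambda_star_sigma_finite : sigma_finite setT Lam.
Proof.
pose b n r := ((r <= n%:R) && (pow_density a r <= n%:R))%R.
have mb n : measurable_fun setT (b n).
  apply: measurable_and; first exact: measurable_fun_ler.
  by apply: measurable_fun_ler => //; exact: measurable_pow_density.
pose B n := b n @^-1` [set true].
have mB n : measurable (B n) by rewrite -[B n]setTI; exact: mb.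
have mx0 : measurable_fun setT (fun x : pstar R => fine (pstar_val x 0%N)).
  by apply: measurableT_comp => //; exact: measurable_coord.
have mBx n : measurable ((fun x => fine (pstar_val x 0%N)) @^-1` B n).
  by rewrite -[X in measurable X]setTI; exact: mx0.
exists (fun n => (fun x => fine (pstar_val x 0%N)) @^-1` B n).
  apply/seteqP; split => // x _; set r := fine (pstar_val x 0%N).
  pose M := Num.max r (pow_density a r).
  exists (Num.truncn M).+1 => //; rewrite /B /b /= -ge_max.
  by rewrite ltW// truncnS_gt.
move=> n; split => //.
pose g r := (\1_(B n `&` `]0%R, +oo[) r)%:E : \bar R.
have mBn : measurable (B n `&` `]0%R, +oo[) by exact: measurableI.
have mg : measurable_fun setT g by exact/measurable_EFinP.
have g0 r : 0 <= g r by rewrite lee_fin.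
apply: (@le_lt_trans _ _ (\int[Lam]_x on_fin g (pstar_val x 0%N))).
  rewrite -[X in Lam X]setIT -integral_indic//; apply: ge0_le_integral => //.
  - exact/measurable_EFinP.
  - apply: (@measurable_on_fin _ _ (g \o snd)); last exact: measurable_coord.
    exact: measurableT_comp.
  - move=> x _; rewrite /on_fin pstar0_lty /g lee_fin !indicE ler_nat.
    rewrite in_setI mem_itv0y fine_gt0 ?andbT//.
    by rewrite pstar_gt0 pstar0_lty.
apply: (@le_lt_trans _ _
    (\sum_(0 <= k <oo) \int[Lam]_x on_fin g (pstar_val x k))).
  rewrite (nneseriesD1 (n := 0%N))//.
    by rewrite leeDl// nneseries_ge0// => k _ _; apply: integral_ge0 => x _;
      exact: on_fin_ge0.
  by move=> k _; apply: integral_ge0 => x _; exact: on_fin_ge0.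
rewrite integral_Lambda_star_atoms//; apply: lte_mul_pinfty => //.
- exact: c_lambda_ge0.
- by rewrite ge0_fin_numE// c_lambda_ge0.
apply: (@le_lt_trans _ _ (\int[mu]_(y in `[0%R, n%:R]) (cst n%:R%:E) y)).
  rewrite [leRHS]integral_mkcond; apply: ge0_le_integral => //.
  - by move=> y _; rewrite mule_ge0// lee_fin pow_density_ge0.
  - apply: emeasurable_funM => //; apply/measurable_EFinP.
    exact: measurable_pow_density.
  - by apply/(measurable_restrictT _ _).1 => //.
  - move=> y _; rewrite patchE mem_setE in_itv/=.
    rewrite /g indicE in_setI mem_itv0y.
    have [yB|yB] := boolP (y \in B n); last first.
      by rewrite mule0; case: ifP => //; rewrite lee_fin.
    have /andP[yn pn] : b n y by move: yB; rewrite inE.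
    have [y0|y0] := ltP 0%R y; last first.
      by rewrite mule0; case: ifP => //; rewrite lee_fin.
    by rewrite (ltW y0) yn mule1 lee_fin.
rewrite integral_cst//= lebesgue_measure_itv/=; case: ifP => _.
  by rewrite -EFinB -EFinM ltry.
by rewrite mule0.
Qed.

Hypothesis c_norm : c_lambda a lam * (Gamma a)%:E = 1.

Lemma c_lambdaE : c_lambda a lam = (Gamma a)^-1%:E.
Proof.
have := c_lambda_ge0; move: c_fin c_norm; case: (c_lambda a lam) => // c _.
rewrite -EFinM => -[cG] _; congr (_%:E).
have G0 : Gamma a != 0%R.
  by apply/eqP => G0; move/eqP: cG; rewrite G0 mulr0 eq_sym oner_eq0.
by apply: (mulIf G0); rewrite cG mulVf.
Qed.

(** The sign is read off the normalization: this number is c(lambda). *)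
Lemma Gamma_inv_ge0 : (0 <= (Gamma a)^-1)%R.
Proof. by rewrite -lee_fin -c_lambdaE c_lambda_ge0. Qed.

(** For fixed k, Campbell's formula gives the integral of h(s, x_k) against ds Lambda^*(dx). Summing
    over k under the integral in s produces c(lambda) = 1 / Gamma(a) times the power density. *)
Lemma campbell_children d (Omega : measurableType d) (P : probability Omega R)
    (X : nat -> Omega -> R * pstar R) (h : R * R -> \bar R) :
  poisson_process P (intensity Lam) X ->
  measurable_fun setT h -> (forall z, 0 <= h z) ->
  \sum_(0 <= j <oo) \sum_(0 <= k <oo)
    \int[P]_w on_fin (fun r => h ((X j w).1, r)) (pstar_val (X j w).2 k) =
  \int[mu]_s \int[mu]_x ((rate a s x)%:E * h (s, x)).
Proof.
move=> ppX mh h0.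
(* [mu] is a measure for the display of [measurableTypeR R], which differs from *)
(* the display of [R]: its image by the identity is a measure for the latter.   *)
have mid : measurable_fun setT (idfun : measurableTypeR R -> R).
  by move=> _ A mA; rewrite setTI.
pose mupos := mrestr mu (measurable_itv `]0%R, +oo[).
have fin1 : sigma_finite setT (pushforward_measure mupos mid).
  have [F FT Ffin] := sigma_finiteT mu; exists F => // i.
  have [mFi Fi] := Ffin i; split => //; apply: le_lt_trans Fi.
  by apply: le_measure; rewrite ?inE//; exact: measurableI.
pose m1 : {sigma_finite_measure set R -> \bar R} := sigma_finite_copy fin1.
pose m2 : {sigma_finite_measure set (pstar R) -> \bar R} :=
  sigma_finite_copy Lambda_star_sigma_finite.
pose M : {measure set (R * pstar R) -> \bar R} := (m1 \x m2).
have integral_m1 (F : R -> \bar R) : measurable_fun setT F ->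
    (forall x, 0 <= F x) -> \int[m1]_s F s = \int[mu]_(s in `]0%R, +oo[) F s.
  move=> mF F0; rewrite (ge0_integral_pushforward mid)// preimage_setT.
  by rewrite ge0_integral_mrestr.
have mE A : measurable A -> intensity Lam A = M A.
  move=> mA; rewrite /M /= [RHS]/product_measure1.
  rewrite (ge0_integral_pushforward mid)//.
  exact: (measurable_fun_xsection m2).
rewrite nneseries_interchange; last first.
  by move=> j k; apply: integral_ge0 => w _; exact: on_fin_ge0.
pose g k (z : R * pstar R) := on_fin (fun r => h (z.1, r)) (pstar_val z.2 k).
have mg k : measurable_fun setT (g k).
  apply: (@measurable_on_fin _ _ (fun t => h (t.1.1, t.2))).
    apply: (measurableT_comp mh); apply: measurable_fun_pair => //.
    exact: measurableT_comp.
  by apply: (measurableT_comp (measurable_coord k)).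
have g0 k z : 0 <= g k z by exact: on_fin_ge0.
transitivity (\sum_(0 <= k <oo) \int[M]_z g k z).
  by apply: eq_eseriesr => k _; exact: campbell ppX mE (mg k) (g0 k).
have mF k : measurable_fun setT
    (fubini_F m2 (g k)).
  exact: measurable_fun_fubini_tonelli_F.
have F0 k s : 0 <= fubini_F m2 (g k) s.
  exact: integral_ge0.
transitivity (\sum_(0 <= k <oo) \int[mu]_(s in `]0%R, +oo[)
    fubini_F m2 (g k) s).
  by apply: eq_eseriesr => k _; rewrite fubini_tonelli1// integral_m1.
rewrite -integral_nneseries//; last first.
  by move=> k; apply: measurable_funTS; exact: mF.
rewrite integral_mkcond; apply: eq_integral => s _; rewrite patchE mem_itv0y.
have mhs : measurable_fun setT (fun x => h (s, x)).
  exact: (measurable_fun_pair2 s mh).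
rewrite /rate indicE mem_itv0y; case: ifP => s0; last first.
  by rewrite integral0_eq// => x _; rewrite mul0r mul0e.
under eq_integral do rewrite mul1r EFinM -muleA.
rewrite ge0_integralZl//; last 3 first.
- apply: emeasurable_funM => //; apply/measurable_EFinP.
  exact: measurable_pow_density.
- by move=> x _; rewrite mule_ge0// lee_fin pow_density_ge0.
- by rewrite lee_fin Gamma_inv_ge0.
by rewrite -c_lambdaE -integral_Lambda_star_atoms.
Qed.

End fix_lambda.

End lambda_star.

(** * The branching random walk *)

Section esum_words.
Variable R : realType.
Local Open Scope ereal_scope.

(** Pickling codes turn the sum into a series over nat, where monotone convergence applies; a number
    that codes nothing contributes 0. *)
Lemma integral_esum_countable (T : countType) d (Omega : measurableType d)
    (m : {measure set Omega -> \bar R}) (g : T -> Omega -> \bar R) (A : set T) :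
  (forall u, A u -> measurable_fun setT (g u)) ->
  (forall u w, A u -> 0 <= g u w) ->
  \int[m]_w (\esum_(u in A) g u w) = \esum_(u in A) \int[m]_w g u w.
Proof.
move=> mg g0.
pose h u w := if u \in A then g u w else 0.
have h0 u w : 0 <= h u w by rewrite /h; case: ifP => // /set_mem /g0.
have mh u : measurable_fun setT (h u).
  by rewrite /h; case: (boolP (u \in A)) => // /set_mem /mg.
pose k i w := if @pickle_inv T i is Some u then h u w else 0.
have k0 i w : 0 <= k i w by rewrite /k; case: (@pickle_inv T i).
have mk i : measurable_fun setT (k i) by rewrite /k; case: (@pickle_inv T i).
have pickle_bij : set_bij [set: T] [set pickle u | u in [set: T]] pickle.
  split => [u _|u v _ _ /(pcan_inj pickleK)//|i [u _ <-]]; first by exists u.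
  by exists u.
have esumE (f : nat -> \bar R) : (forall i, 0 <= f i) ->
    (forall i, @pickle_inv T i = None -> f i = 0) ->
    \esum_(u in [set: T]) f (pickle u) = \sum_(0 <= i <oo) f i.
  move=> f0 fN; rewrite -(reindex_esum _ _ _ f pickle_bij) nneseries_esumT//.
  rewrite [LHS]esum_mkcond; apply: eq_esum => i _; case: ifPn => // iP.
  rewrite fN//; apply/eqP; apply: contraNT iP.
  case E : (@pickle_inv T i) => [u|]// _; rewrite inE; exists u => //.
  by have := @pickle_invK T i; rewrite /ocancel E.
have kE u w : k (pickle u) w = h u w by rewrite /k pickleK_inv.
rewrite [RHS]esum_mkcond.
transitivity (\int[m]_w \sum_(0 <= i <oo) k i w).
  apply: eq_integral => w _; rewrite esum_mkcond -esumE//.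
    by apply: eq_esum => u _; rewrite kE.
  by move=> i iN; rewrite /k iN.
rewrite integral_nneseries// -esumE.
- apply: eq_esum => u _; under eq_integral do rewrite kE.
  by rewrite /h; case: ifP => // _; rewrite integral0.
- by move=> i; exact: integral_ge0.
- by move=> i iN; rewrite integral0_eq// => w _; rewrite /k iN.
Qed.

Lemma esum_words_cons (a : word -> \bar R) n : (forall u, 0 <= a u) ->
  \esum_(u in [set u | size u = n.+1]) a u =
  \esum_(v in [set v | size v = n])
     \sum_(0 <= j <oo) \sum_(0 <= k <oo) a ((j, k) :: v).
Proof.
move=> a0.
transitivity (\esum_(v in [set v | size v = n])
    \esum_(z in [set: nat * nat]) a (z :: v)).
  rewrite esum_esum//; apply: reindex_esum; split.
  - by move=> [v z] [/= vn _]; rewrite vn.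
  - by move=> [v z] [v' z'] _ _ /= [-> ->].
  - by move=> [//|z v] /= [vn]; exists (v, z).
apply: eq_esum => v _.
rewrite nneseries_esumT; last by move=> j; apply: nneseries_ge0.
under [RHS]eq_esum do rewrite nneseries_esumT//.
rewrite esum_esum//.
rewrite (_ : [set: nat] `*`` (fun=> setT) = setT); last first.
  by apply/seteqP; split.
by apply: eq_esum => -[j k].
Qed.

End esum_words.

(** * States of words *)

Section words.
Context {R : realType} {d : measure_display} {Omega : measurableType d}.
Variable N : word -> nat -> Omega -> R * pstar R.

(** The current point is kept beside the tuple of points so that generation 0, whose tuple is empty,
    has one too. *)
Definition push n (z : ((R * R) * n.-tuple (R * R)) * (R * R)) :
    (R * R) * n.+1.-tuple (R * R) :=
  (z.1.1 + z.2, [tuple of rcons z.1.2 (z.1.1 + z.2)]).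

Lemma tnth_rcons_ord T n (t : n.-tuple T) x (i : 'I_n.+1) :
  tnth [tuple of rcons t x] i =
  if insub (i : nat) is Some j then tnth t j else x.
Proof.
rewrite (tnth_nth x) nth_rcons size_tuple; case: insubP => [j -> ji|].
  by rewrite (tnth_nth x) -ji.
rewrite -leqNgt => ni; rewrite ltnNge ni /= ifT// eqn_leq ni andbT.
by rewrite -ltnS ltn_ord.
Qed.

Lemma measurable_rcons d1 d2 (T1 : measurableType d1) (T2 : measurableType d2)
    n (f : T1 -> n.-tuple T2) (g : T1 -> T2) :
  measurable_fun setT f -> measurable_fun setT g ->
  measurable_fun setT (fun x => [tuple of rcons (f x) (g x)]).
Proof.
move=> mf mg; apply/measurable_fun_tnthP => i.
rewrite (_ : _ \o _ = fun x =>
    if insub (i : nat) is Some j then tnth (f x) j else g x); last first.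
  by apply/funext => x; exact: tnth_rcons_ord.
by case: insub => // j; exact: (measurableT_comp (measurable_tnth j) mf).
Qed.

Lemma measurable_addp d1 (T1 : measurableType d1) (f g : T1 -> R * R) :
  measurable_fun setT f -> measurable_fun setT g ->
  measurable_fun setT (fun x => f x + g x).
Proof.
move=> mf mg.
rewrite (_ : (fun x => _) =
  fun x => ((f x).1 + (g x).1, (f x).2 + (g x).2)); last by [].
by apply: measurable_fun_pair; apply: measurable_funD; exact: measurableT_comp.
Qed.

Lemma measurable_push n : measurable_fun setT (@push n).
Proof.
have mD : measurable_fun setT
    (fun z : ((R * R) * n.-tuple (R * R)) * (R * R) => z.1.1 + z.2).
  by apply: measurable_addp => //; exact: measurableT_comp.
apply: measurable_fun_pair => //; apply: measurable_rcons => //.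
exact: measurableT_comp.
Qed.

Definition state n (w : Omega) (u : word) : (R * R) * n.-tuple (R * R) :=
  (position N w u, [tuple ancestor N w u i.+1 | i < n]).

Lemma state_cons n w v j k : size v = n ->
  state n.+1 w ((j, k) :: v) =
  push (state n w v, ((N v j w).1, fine (pstar_val (N v j w).2 k))).
Proof.
move=> vn; congr pair; apply: eq_from_tnth => i.
rewrite tnth_rcons_ord tnth_mktuple /ancestor /=; case: insubP => [l _ li|].
  rewrite tnth_mktuple /ancestor vn -li subSS.
  (* The number of dropped letters becomes a successor, so that [drop] removes the head (j, k) and
     the ancestor is read off v. *)
  by rewrite -[in LHS]subnSK; last exact: ltn_ord.
rewrite -leqNgt => ni; have -> : nat_of_ord i = n.
  by apply/eqP; rewrite eqn_leq ni andbT -ltnS ltn_ord.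
by rewrite vn subnn.
Qed.

End words.

(** * The one-step operator common to both recursions *)

Section kernel.
Context {R : realType}.
Variable a : R.
Hypothesis GammaV_ge0 : 0 <= (Gamma a)^-1.
Local Notation mu := (@lebesgue_measure R).

Definition kernel n
    (H : (R * R) * n.+1.-tuple (R * R) -> \bar R)
    (z : (R * R) * n.-tuple (R * R)) : \bar R :=
  (\int[mu]_s \int[mu]_x ((rate a s x)%:E * H (push (z, (s, x)))))%E.

Lemma kernel_ge0 n (H : (R * R) * n.+1.-tuple (R * R) -> \bar R) z :
  (forall z, 0 <= H z)%E -> (0 <= kernel H z)%E.
Proof.
move=> H0; apply: integral_ge0 => s _; apply: integral_ge0 => x _.
by rewrite mule_ge0// lee_fin rate_ge0.
Qed.

Lemma measurable_kernel n (H : (R * R) * n.+1.-tuple (R * R) -> \bar R) :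
  measurable_fun setT H -> (forall z, 0 <= H z)%E ->
  measurable_fun setT (kernel H).
Proof.
move=> mH H0.
pose g (y : (((R * R) * n.-tuple (R * R)) * R) * R) : \bar R :=
  ((rate a y.1.2 y.2)%:E * H (push (y.1.1, (y.1.2, y.2))))%E.
have g0 y : (0 <= g y)%E by rewrite mule_ge0// lee_fin rate_ge0.
have m12 : measurable_fun setT
    (fun y : (((R * R) * n.-tuple (R * R)) * R) * R => y.1.2).
  exact: measurableT_comp.
have m11 : measurable_fun setT
    (fun y : (((R * R) * n.-tuple (R * R)) * R) * R => y.1.1).
  exact: measurableT_comp.
have msx : measurable_fun setT
    (fun y : (((R * R) * n.-tuple (R * R)) * R) * R => (y.1.2, y.2)).
  exact: measurable_fun_pair.
have mg : measurable_fun setT g.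
  apply: emeasurable_funM.
    apply/measurable_EFinP.
    exact: (measurableT_comp (measurable_rate a) msx).
  apply: (measurableT_comp mH).
  apply: (measurableT_comp (@measurable_push _ n)).
  exact: measurable_fun_pair.
have mG : measurable_fun setT (fubini_F mu g).
  exact: measurable_fun_fubini_tonelli_F.
have G0 y : (0 <= fubini_F mu g y)%E by exact: integral_ge0.
exact: (measurable_fun_fubini_tonelli_F (m2 := mu) _ mG G0).
Qed.

End kernel.

(** * The recursion over generations *)

Section generation_sum.
Context {R : realType} {d : measure_display} {Omega : measurableType d}.
Variables (a : R) (lam : {finite_measure set (pstar R) -> \bar R}).
Variable Lam : {measure set (pstar R) -> \bar R}.
Variable P : probability Omega R.
Variable N : word -> nat -> Omega -> R * pstar R.
Hypothesis LamE : is_Lambda_star a lam Lam.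
Hypothesis c_fin : (c_lambda a lam < +oo)%E.
Hypothesis c_norm : (c_lambda a lam * (Gamma a)%:E = 1)%E.
Hypothesis brwN : is_brw P Lam N.
Let F (u : word) := sigma_of (N u).

Definition shorter n : set word := [set u : word | (size u < n)%N].

Definition atoms u : set Omega := [set w | is_atom N w u].

Let mF u : F u `<=` measurable.
Proof.
apply: smallest_sub; first exact: sigma_algebra_measurable.
move=> _ [j _ [B mB <-]].
have mN1 := pp_measurable (brw_poisson brwN u) j.
exact: (mN1 measurableT B mB).
Qed.

Let NF u j B : measurable B -> F u (N u j @^-1` B).
Proof.
by move=> mB; apply: sub_sigma_algebra; exists j => //; exists B;
  rewrite ?setTI.
Qed.

Let mN u j : measurable_fun setT (N u j).
Proof. exact: pp_measurable (brw_poisson brwN u) j. Qed.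

Definition finite_entry n k :
    set (((R * R) * n.-tuple (R * R)) * (R * pstar R)) :=
  [set z | (pstar_val z.2.2 k < +oo)%E].

Definition push_child n k (z : ((R * R) * n.-tuple (R * R)) * (R * pstar R)) :=
  push (z.1, (z.2.1, fine (pstar_val z.2.2 k))).

Lemma measurable_finite_entry n k : measurable (@finite_entry n k).
Proof.
rewrite -[X in measurable X]setTI; apply: measurable_lte => //.
by apply: (measurableT_comp (measurable_coord k)); exact: measurableT_comp.
Qed.

Lemma measurable_push_child n k : measurable_fun setT (@push_child n k).
Proof.
apply: (measurableT_comp (@measurable_push _ n)).
apply: measurable_fun_pair => //; apply: measurable_fun_pair.
  exact: measurableT_comp.
apply: measurableT_comp => //.
by apply: (measurableT_comp (measurable_coord k)); exact: measurableT_comp.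
Qed.

Lemma atoms_cons j k v n :
  atoms ((j, k) :: v) =
  (fun w => (state N n w v, N v j w)) @^-1` finite_entry k `&` atoms v.
Proof.
apply/seteqP; split => w; rewrite /atoms /finite_entry /=.
  by move=> /andP[].
by move=> [? ?]; apply/andP.
Qed.

(** The state of u is built from the Poisson processes at its proper ancestors, all shorter than u.
    In the induction, the process of the parent v is independent of the state of v; absorbing it
    spends the index v, and longer words avoid v as well as all words shorter than v. *)
Lemma state_spec n u : size u = n ->
  [/\ measurable_fun setT (fun w => state N n w u), measurable (atoms u)
    & indep_of P (events_off F (shorter n)) (atoms u)
        (fun w => state N n w u)].
Proof.
elim: u n => [|[j k] v IH] n; rewrite /= => <-{n}.
  have -> : atoms [::] = setT by apply/seteqP; split.
  have -> : (fun w => state N 0 w [::]) =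
      cst ((0, 0), [tuple of [::]]) :> (Omega -> (R * R) * 0.-tuple (R * R)).
    by apply/funext => w; congr pair; apply: val_inj; rewrite /= enum_ord0.
  split => // D A CD mA; rewrite setIT preimage_cst.
  case: ifP => _; first by rewrite setIT probability_setT mule1.
  by rewrite setI0 measure0 mule0.
have [mX mA indX] := IH _ erefl.
pose XY w := (state N (size v) w v, N v j w).
have mXY : measurable_fun setT XY by exact: measurable_fun_pair.
have vv : ~ shorter (size v) v by rewrite /shorter /= ltnn.
have indXY := indep_of_next_pair mF (brw_indep brwN) mX (mN v j) vv mA
  (@NF v j) indX.
have stE : (fun w => state N (size v).+1 w ((j, k) :: v)) =
    @push_child (size v) k \o XY.
  by apply/funext => w; rewrite state_cons.
rewrite (atoms_cons j k v (size v)) stE; split.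
- exact: (measurableT_comp (@measurable_push_child _ k)).
- apply: measurableI => //; rewrite -[X in measurable X]setTI.
  by apply: mXY => //; exact: measurable_finite_entry.
- apply: indep_of_comp indXY.
  + apply: events_offS => u [|->]; rewrite /shorter /= ltnS; last by [].
    exact: ltnW.
  + exact: measurable_finite_entry.
  + exact: measurable_push_child.
Qed.

(** Being an atom goes into the domain of integration, which makes the index set of the sum
    deterministic. *)
Definition generation_sum n
    (H : (R * R) * n.-tuple (R * R) -> \bar R) : \bar R :=
  (\esum_(u in [set u : word | size u = n])
     \int[P]_(w in atoms u) H (state N n w u))%E.

(** The children of v depend on its state and on the independent process [N v]. With the state
    frozen, that process is integrated out, and the sum over all children is given by
    [campbell_children]. *)
Lemma generation_sumS n (H : (R * R) * n.+1.-tuple (R * R) -> \bar R) :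
  measurable_fun setT H -> (forall z, 0 <= H z)%E ->
  generation_sum H = generation_sum (kernel a H).
Proof.
move=> mH H0; rewrite /generation_sum esum_words_cons; last first.
  by move=> u; exact: integral_ge0.
apply: eq_esum => v /= vn; have [mX mA indX] := state_spec vn.
have vv : ~ shorter n v by rewrite /shorter /= vn ltnn.
pose h z (y : R * R) := H (push (z, y)).
have mh : measurable_fun setT
    (fun zy : ((R * R) * n.-tuple (R * R)) * (R * R) => h zy.1 zy.2).
  apply: (measurableT_comp mH).
  rewrite (_ : (fun zy => _) = @push R n); first exact: measurable_push.
  by apply/funext => -[].
pose g k (z : ((R * R) * n.-tuple (R * R)) * (R * pstar R)) : \bar R :=
  on_fin (fun r => h z.1 (z.2.1, r)) (pstar_val z.2.2 k).
have mg k : measurable_fun setT (g k).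
  pose f (t : (((R * R) * n.-tuple (R * R)) * (R * pstar R)) * R) :=
    h t.1.1 (t.1.2.1, t.2).
  apply: (@measurable_on_fin _ _ _ f).
    have mt : measurable_fun setT
        (fun t : (((R * R) * n.-tuple (R * R)) * (R * pstar R)) * R =>
          (t.1.1, (t.1.2.1, t.2))).
      apply: measurable_fun_pair; first exact: measurableT_comp.
      apply: measurable_fun_pair => //.
      by apply: measurableT_comp => //; exact: measurableT_comp.
    exact: (measurableT_comp mh mt).
  by apply: (measurableT_comp (measurable_coord k)); exact: measurableT_comp.
have g0 k z : (0 <= g k z)%E by apply: on_fin_ge0 => r; exact: H0.
transitivity (\sum_(0 <= j <oo) \sum_(0 <= k <oo)
    \int[P]_(w in atoms v) \int[P]_w' g k (state N n w v, N v j w'))%E.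
  apply: eq_eseriesr => j _; apply: eq_eseriesr => k _.
  rewrite -(ge0_integral_indep_next (brw_indep brwN) mX (mN v j) vv mA
    (@NF v j) indX)//.
  rewrite (atoms_cons j k v n) [LHS]integral_mkcond [RHS]integral_mkcond.
  apply: eq_integral => w _; rewrite !patchE in_setI /g /on_fin /=.
  have -> : (w \in (fun w0 => (state N n w0 v, N v j w0)) @^-1` finite_entry k)
      = (pstar_val (N v j w).2 k < +oo)%E.
    by apply/idP/idP => [/set_mem//|wk]; exact/mem_set.
  rewrite state_cons//.
  by case: (pstar_val _ _ < +oo)%E; case: (w \in atoms v).
have mfX k j : measurable_fun setT
    (fun z => \int[P]_w' g k (z, N v j w'))%E.
  pose f (t : ((R * R) * n.-tuple (R * R)) * Omega) := g k (t.1, N v j t.2).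
  apply: (measurable_fun_fubini_tonelli_F (m2 := P) f).
    apply: (measurableT_comp (mg k)); apply: measurable_fun_pair => //.
    exact: measurableT_comp.
  by move=> t; exact: g0.
have fX0 k j z : (0 <= \int[P]_w' g k (z, N v j w'))%E by exact: integral_ge0.
transitivity (\int[P]_(w in atoms v) \sum_(0 <= j <oo) \sum_(0 <= k <oo)
    \int[P]_w' g k (state N n w v, N v j w'))%E.
  rewrite integral_nneseries//; last 2 first.
  - move=> j; apply: ge0_emeasurable_sum => [k w _ _|k _]; first exact: fX0.
    apply: measurable_funTS; exact: (measurableT_comp (mfX k j) mX).
  - by move=> j w _; exact: nneseries_ge0.
  apply: eq_eseriesr => j _; rewrite integral_nneseries// => k.
  apply: measurable_funTS; exact: (measurableT_comp (mfX k j) mX).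
apply: eq_integral => w _; rewrite /kernel.
rewrite -(campbell_children LamE c_fin c_norm (brw_poisson brwN v)
  (h := h (state N n w v)))//; last by move=> z; exact: H0.
exact: (measurable_fun_pair2 (state N n w v) mh).
Qed.

End generation_sum.

(** * The walk *)

Section walk.
Context {R : realType} {d : measure_display} {Omega : measurableType d}.
Variables (a : R) (Q : probability Omega R) (S U : nat -> Omega -> R).
Hypothesis GammaV_ge0 : 0 <= (Gamma a)^-1.
Hypothesis walkS : is_gamma_walk Q a S.
Hypothesis unifU : is_iid_uniform Q U.
Hypothesis indSU : indep_seqs Q S U.
Local Notation mu := (@lebesgue_measure R).

Definition increment n w := S n.+1 w - S n w.

Lemma measurable_increment n : measurable_fun setT (increment n).
Proof. by apply: measurable_funB; exact: (walk_measurable walkS). Qed.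

(** Uniforms and increments form one independent family, so that the step lemmas used for words add
    them one at a time. *)
Definition driver (i : bool * nat) : Omega -> R :=
  if i.1 then U i.2 else increment i.2.

Lemma measurable_driver i : measurable_fun setT (driver i).
Proof.
rewrite /driver; case: i.1; first exact: (unif_measurable unifU).
exact: measurable_increment.
Qed.

Definition driver_events (i : bool * nat) : set (set Omega) :=
  preimage_set_system setT (driver i) measurable.

Lemma driver_events_measurable i : driver_events i `<=` measurable.
Proof. by move=> _ [B mB <-]; exact: measurable_driver. Qed.

Lemma driver_events_preimage i B :
  measurable B -> driver_events i (driver i @^-1` B).
Proof. by move=> mB; exists B; rewrite ?setTI. Qed.

Lemma prod_filter_pairs (J : seq (bool * nat)) (b : bool) T (x : T)
    (op : Monoid.com_law x) (f : bool * nat -> T) :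
  \big[op/x]_(i <- J | i.1 == b) f i =
  \big[op/x]_(k <- [seq i.2 | i <- J & i.1 == b]) f (b, k).
Proof.
rewrite big_map big_filter; apply: eq_bigr => -[c k] /= /eqP ->.
by [].
Qed.

Lemma uniq_filter_pairs (J : seq (bool * nat)) (b : bool) :
  uniq J -> uniq [seq i.2 | i <- J & i.1 == b].
Proof.
move=> uJ; rewrite map_inj_in_uniq ?filter_uniq//.
move=> [c k] [c' k']; rewrite !mem_filter /= => /andP[/eqP -> _].
by move=> /andP[/eqP -> _] ->.
Qed.

(** The list of indices is split into uniforms and increments. The two blocks are independent
    because increments are measurable for the sigma-algebra of S, and each block factorizes by
    itself. *)
Lemma indep_driver : indep_sigma Q driver_events.
Proof.
move=> J E uJ JF.
have split_set : \bigcap_(i in [set` J]) E i =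
    (\big[setI/setT]_(i <- J | i.1 == true) E i) `&`
    (\big[setI/setT]_(i <- J | i.1 == false) E i).
  rewrite bigcap_seq (bigID (fun i => i.1 == true)) /=; congr (_ `&` _).
  by apply: eq_bigl => -[[] k].
pose A b : set Omega := \big[setI/setT]_(i <- J | i.1 == b) E i.
have AE b : A b = \bigcap_(k in [set` [seq i.2 | i <- J & i.1 == b]]) E (b, k).
  by rewrite /A prod_filter_pairs bigcap_seq.
have JE b k : k \in [seq i.2 | i <- J & i.1 == b] ->
    driver_events (b, k) (E (b, k)).
  move=> /mapP[[c l]]; rewrite mem_filter /= => /andP[/eqP -> blJ] ->.
  exact: JF.
have QA b : Q (A b) = (\prod_(i <- J | i.1 == b) Q (E i))%E.
  rewrite AE prod_filter_pairs; case: b (JE b) => JEb.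
    exact: (unif_indep unifU (uniq_filter_pairs _ uJ) JEb).
  exact: (walk_indep walkS (uniq_filter_pairs _ uJ) JEb).
have sigA (X : nat -> Omega -> R) b :
    (forall k, k \in [seq i.2 | i <- J & i.1 == b] -> sigma_of X (E (b, k))) ->
    sigma_of X (A b).
  move=> XE; rewrite /A prod_filter_pairs big_seq.
  exact: (@bigsetI_measurable _ (g_sigma_algebraType
    (\bigcup_i preimage_set_system setT (X i) measurable))).
have sigX (X : nat -> Omega -> R) n B :
    measurable B -> sigma_of X (X n @^-1` B).
  by move=> mB; apply: sub_sigma_algebra; exists n => //; exists B;
    rewrite ?setTI.
have sigU : sigma_of U (A true).
  by apply: sigA => k /JE [B mB <-]; rewrite setTI; exact: sigX.
have sigS : sigma_of S (A false).
  apply: sigA => k /JE [B mB <-].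
  pose T := g_sigma_algebraType
    (\bigcup_i preimage_set_system setT (S i) measurable).
  have mS n : measurable_fun [set: T] (S n : T -> R).
    by move=> _ C mC; rewrite setTI; exact: (sigX S n C mC).
  exact: (measurable_funB (mS k.+1) (mS k)).
(* The flag [true] stands for S in [indep_seqs] but for U in [driver], hence the exchange. *)
pose C (b : bool) := if b then A false else A true.
have := indSU (J := [:: true; false]) (E := C) isT.
rewrite bigcap_seq !big_cons !big_nil setIT mule1 /C => H.
rewrite split_set setIC H; last by move=> [].
rewrite (bigID (fun i : bool * nat => i.1 == true)) /= muleC QA.
by rewrite QA; congr (_ * _)%E; apply: eq_bigl => -[[] k].
Qed.

Local Open Scope ereal_scope.

Let measurable_codom (X : Omega -> R) : measurable_fun setT X ->
  measurable_fun setT (X : Omega -> measurableTypeR R).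
Proof. by move=> mX _ A mA; exact: mX. Qed.

Lemma integral_uniform_law n (g : R -> \bar R) :
  measurable_fun setT g -> (forall x, 0 <= g x) ->
  \int[Q]_w g (U n w) = \int[mu]_(x in `[0%R, 1%R]) g x.
Proof.
move=> mg g0.
have mU := measurable_codom (unif_measurable unifU n).
pose m := pushforward_measure Q mU.
transitivity (\int[m]_x g x).
  by rewrite (ge0_integral_pushforward mU)// preimage_setT.
transitivity (\int[uniform_prob (@ltr01 R)]_x g x).
  by apply: eq_measure_integral => A mA _; exact: (unif_law unifU).
by rewrite integral_uniform// subr0 invr1 mul1e.
Qed.

Lemma integral_gamma_law n (g : R -> \bar R) :
  measurable_fun setT g -> (forall x, 0 <= g x) ->
  \int[Q]_w g (increment n w) =
  \int[mu]_x (g x * ((Gamma a)^-1 * pow_density a x * expR (- x))%:E).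
Proof.
move=> mg g0.
have mX := measurable_codom (measurable_increment n).
pose m := pushforward_measure Q mX.
transitivity (\int[m]_x g x).
  by rewrite (ge0_integral_pushforward mX)// preimage_setT.
apply: ge0_integral_density => //.
- apply: measurable_funM.
    by apply: measurable_funM => //; exact: measurable_pow_density.
  by apply: measurableT_comp => //; exact: measurable_expR.
- by move=> x; rewrite mulr_ge0 ?expR_ge0// mulr_ge0 ?pow_density_ge0.
- move=> A mA; rewrite /m /= /pushforward.
  rewrite [LHS](walk_law walkS)// /gamma_prob.
  rewrite [LHS]integral_mkcond [RHS]integral_mkcond; apply: eq_integral => x _.
  rewrite !patchE in_setI; case: (x \in A) => //=.
  rewrite /pow_density indicE /gamma_pdf.
  by case: (x \in _); rewrite ?mulr1// mulr0 mulr0 mul0r.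
Qed.


Local Notation wstate n := (((R * R) * n.-tuple (R * R)) * R)%type.

(** The factor at i = 0 is A_0 = 1, so for n >= 1 this is e^{S_n} A_1 ... A_(n-1). *)
Definition walk_weight n (w : Omega) : R :=
  (expR (S n w) * \prod_(i < n) uprod U i w)%R.

Definition walk_state n (w : Omega) : wstate n :=
  ((((1 - uprod U n w, S n w),
    [tuple (1 - uprod U i.+1 w, S i.+1 w) | i < n]), walk_weight n w))%R.

(* [1 - A_(n+1) = (1 - A_n) + A_n (1 - U_(n+1))]: the time increment is        *)
(* [A_n (1 - U_(n+1))], and [A_n] is 1 minus the current time.                 *)
Definition walk_push n (z : (wstate n * R) * R) : wstate n.+1 :=
  (push (z.1.1.1, ((1 - z.1.1.1.1.1) * (1 - z.1.2), z.2)),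
   z.1.1.2 * (expR z.2 * (1 - z.1.1.1.1.1)))%R.

Lemma walk_stateS n w :
  walk_state n.+1 w = walk_push (walk_state n w, U n w, increment n w).
Proof.
have uS : uprod U n.+1 w = (uprod U n w * U n w)%R.
  by rewrite /uprod big_ord_recr.
have pE : (1 - uprod U n.+1 w, S n.+1 w)%R =
    ((1 - uprod U n w, S n w) + ((1 - (1 - uprod U n w)) * (1 - U n w),
       increment n w))%R.
  rewrite uS /increment; congr pair => /=; ring.
congr pair; last first.
 rewrite /= /walk_weight big_ord_recr /= /increment expRB subKr.
  by field; rewrite gt_eqF ?expR_gt0.
congr pair => //; apply: eq_from_tnth => i; rewrite tnth_rcons_ord tnth_mktuple.
case: insubP => [l _ li|]; first by rewrite tnth_mktuple li.
rewrite -leqNgt => ni; have -> : nat_of_ord i = n.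
  by apply/eqP; rewrite eqn_leq ni andbT -ltnS ltn_ord.
by rewrite pE.
Qed.

Lemma measurable_walk_push n : measurable_fun setT (@walk_push n).
Proof.
have m1 : measurable_fun setT (fun z : (wstate n * R) * R => z.1.1).
  exact: measurableT_comp.
have m2 : measurable_fun setT (fun z : (wstate n * R) * R => z.1.2).
  exact: measurableT_comp.
have m11 : measurable_fun setT (fun z : (wstate n * R) * R => z.1.1.1).
  exact: measurableT_comp.
have m12 : measurable_fun setT (fun z : (wstate n * R) * R => z.1.1.2).
  exact: measurableT_comp.
have mp : measurable_fun setT (fun z : (wstate n * R) * R => z.1.1.1.1).
  exact: measurableT_comp.
have mA : measurable_fun setT
    (fun z : (wstate n * R) * R => 1 - z.1.1.1.1.1)%R.
  by apply: measurable_funB => //; exact: measurableT_comp.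
apply: measurable_fun_pair.
  apply: (measurableT_comp (@measurable_push _ n)).
  apply: measurable_fun_pair => //; apply: measurable_fun_pair => //.
  by apply: measurable_funM => //; exact: measurable_funB.
apply: measurable_funM => //; apply: measurable_funM => //.
by apply: measurableT_comp => //; exact: measurable_expR.
Qed.

Definition before n : set (bool * nat) := [set i | (i.2 < n)%N].

(** The counterpart of [state_spec], with two indices spent at each step: U n, then the increment
    n. *)
Lemma walk_state_spec n :
  measurable_fun setT (walk_state n) /\
  indep_of Q (events_off driver_events (before n)) setT (walk_state n).
Proof.
elim: n => [|n [mZ indZ]].
  have -> : walk_state 0 = cst (((0, 0), [tuple of [::]]), 1)%R.
    apply/funext => w; rewrite /walk_state /walk_weight /uprod !big_ord0.
    rewrite (walk0 walkS) expR0 mulr1 subrr; congr (_, _, _).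
    by apply: val_inj; rewrite /= enum_ord0.
  split => // D A CD mA; rewrite setIT preimage_cst.
  case: ifP => _; first by rewrite setIT probability_setT mule1.
  by rewrite setI0 measure0 mule0.
have mU : measurable_fun setT (U n) by exact: (unif_measurable unifU).
have mX : measurable_fun setT (increment n) by exact: measurable_increment.
have nU : ~ before n (true, n) by rewrite /before /= ltnn.
have nX : ~ (before n `|` [set (true, n)]) (false, n).
  by rewrite /before /= => -[|//]; rewrite ltnn.
have indZU := indep_of_next_pair driver_events_measurable indep_driver mZ mU nU
  measurableT (@driver_events_preimage (true, n)) indZ.
have mZU : measurable_fun setT (fun w => (walk_state n w, U n w)).
  exact: measurable_fun_pair.
have indZUX := indep_of_next_pair driver_events_measurable indep_driver mZU mX
  nX
  measurableT (@driver_events_preimage (false, n)) indZU.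
have -> : walk_state n.+1 = @walk_push n \o
    (fun w => (walk_state n w, U n w, increment n w)).
  by apply/funext => w; exact: walk_stateS.
split.
  apply: (measurableT_comp (@measurable_walk_push n)).
  exact: measurable_fun_pair.
have := indep_of_comp _ measurableT (@measurable_walk_push n) indZUX.
rewrite preimage_setT setIT; apply; apply: events_offS.
move=> i; rewrite /before /= => -[[/ltnW //|->]|->] /=; rewrite ?ltnS //.
Qed.

Definition walk_sum n (H : (R * R) * n.-tuple (R * R) -> \bar R) : \bar R :=
  \int[Q]_w (H (walk_state n w).1 * (walk_state n w).2%:E).

(** Put A = 1 - t, and let phi(s) be the integral over x at time increment s. The weight e^x cancels
    e^(-x) in the gamma density, leaving A times the integral of phi(A (1 - u)) over [0, 1]. The
    substitution s = A (1 - u) makes this the integral of phi over [0, A], beyond which phi is 0. *)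
Lemma integral_walk_push n (H : (R * R) * n.+1.-tuple (R * R) -> \bar R)
    (z : (R * R) * n.-tuple (R * R)) (W : R) :
  measurable_fun setT H -> (forall z, 0 <= H z) ->
  (forall z, (1 < z.1.1)%R -> H z = 0) -> (z.1.1 <= 1)%R -> (0 <= W)%R ->
  \int[mu]_(u in `[0%R, 1%R]) \int[mu]_x
    ((H (walk_push (z, W, u, x)).1 * (walk_push (z, W, u, x)).2%:E) *
     ((Gamma a)^-1 * pow_density a x * expR (- x))%:E) =
  kernel a H z * W%:E.
Proof.
move=> mH H0 Hout; set A : R := (1 - z.1.1)%R => z1 W0.
have A0 : (0 <= A)%R by rewrite subr_ge0.
have dens0 x : 0 <= ((Gamma a)^-1 * pow_density a x)%:E.
  by rewrite lee_fin mulr_ge0// pow_density_ge0.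
pose g (y : R * R) := ((Gamma a)^-1 * pow_density a y.2)%:E * H (push (z, y)).
have g0 y : 0 <= g y by rewrite mule_ge0.
have mg : measurable_fun setT g.
  apply: emeasurable_funM.
    apply/measurable_EFinP; apply: measurable_funM => //.
    exact: (measurableT_comp (measurable_pow_density a)).
  apply: (measurableT_comp mH).
  apply: (measurableT_comp (@measurable_push _ n)).
  exact: measurable_fun_pair.
pose phi (s : R) : \bar R := \int[mu]_x g (s, x).
have phi0 s : 0 <= phi s by exact: integral_ge0.
have mphi : measurable_fun setT phi.
  exact: (measurable_fun_fubini_tonelli_F (m2 := mu) g mg g0).
have phi_out (s : R) : (A < s)%R -> phi s = 0.
  move=> As; rewrite /phi integral0_eq// => x _.
  by rewrite /g Hout ?mule0//= -ltrBlDl.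
pose psi (s : R) : \bar R := (\1_(`]0%R, +oo[) s)%:E * phi s.
have psi0 s : 0 <= psi s by rewrite mule_ge0// lee_fin.
have mpsi : measurable_fun setT psi.
  by apply: emeasurable_funM => //; exact/measurable_EFinP.
have -> : kernel a H z = \int[mu]_s psi s.
  apply: eq_integral => s _; rewrite /psi /phi -ge0_integralZl//; last first.
    exact: (measurable_fun_pair2 s mg).
  by apply: eq_integral => x _; rewrite /g muleA -EFinM.
transitivity (\int[mu]_(u in `[0%R, 1%R]) ((W * A)%:E * phi (A * (1 - u))%R)).
  apply: eq_integral => u _; rewrite /phi -ge0_integralZl//; last 2 first.
  - exact: (measurable_fun_pair2 (A * (1 - u))%R mg).
  - by rewrite lee_fin mulr_ge0.
  apply: eq_integral => x _; rewrite /g /walk_push /= -/A.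
  rewrite -muleA -EFinM [RHS]muleA -EFinM [RHS]muleC; congr (_ * _%:E).
  rewrite expRN; move: (expR x) (expR_gt0 x) (Gamma a)^-1%R => e e0 c.
  by field; rewrite gt_eqF.
have maff : measurable_fun setT (fun u : R => A * (1 - u))%R.
  by apply: measurable_funM => //; exact: measurable_funB.
have mphiA : measurable_fun setT (fun u : R => phi (A * (1 - u))%R).
  exact: (measurableT_comp mphi maff).
rewrite ge0_integralZl//; last 2 first.
- exact: measurable_funTS.
- by rewrite lee_fin mulr_ge0.
rewrite EFinM -muleA [RHS]muleC; congr (_ * _).
(* For A = 0 the substitution degenerates, but phi vanishes on ]0, +oo[ and both sides are 0. *)
have [A_gt0|A_le0] := ltP 0%R A; last first.
  have -> : A = 0%R by apply/eqP; rewrite eq_le A_le0.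
  rewrite mul0e integral0_eq// => s _.
  rewrite /psi indicE mem_itv0y; case: ltP => s0; rewrite ?mul0e//.
  by rewrite phi_out ?mule0//; exact: le_lt_trans s0.
rewrite [RHS](@ge0_integral_affine _ (- A) A)//; last first.
  by rewrite oppr_eq0 gt_eqF.
rewrite normrN gtr0_norm//; congr (_ * _).
(* The endpoint u = 1 corresponds to s = 0, which the indicator in [psi] excludes; it is removed as
   a null point. *)
rewrite -integral_itv_bndo_bndc; last exact: measurable_funTS.
rewrite integral_mkcond; apply: eq_integral => u _.
have -> : (- A * u + A = A * (1 - u))%R by ring.
rewrite patchE mem_setE in_itv/= /psi indicE mem_itv0y pmulr_rgt0// subr_gt0.
have [u1|u1] := ltP u 1%R; last by rewrite andbF mul0e.
rewrite andbT mul1e; case: leP => // u0.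
by rewrite phi_out// ltr_pMr// ltrDl oppr_gt0.
Qed.

Lemma walk_weight_ge0 n w : (0 <= walk_weight n w)%R.
Proof.
rewrite mulr_ge0 ?expR_ge0// prodr_ge0// => i _; rewrite prodr_ge0// => j _.
by have /andP[] := unif_itv unifU j w.
Qed.

Lemma uprod_ge0 n w : (0 <= uprod U n w)%R.
Proof.
by apply: prodr_ge0 => j _; have /andP[] := unif_itv unifU j w.
Qed.

(** With the current state frozen, the new increment and then the new uniform are integrated out,
    which leaves the integral of [integral_walk_push]. *)
Lemma walk_sumS n (H : (R * R) * n.+1.-tuple (R * R) -> \bar R) :
  measurable_fun setT H -> (forall z, 0 <= H z) ->
  (forall z, (1 < z.1.1)%R -> H z = 0) ->
  walk_sum H = walk_sum (kernel a H).
Proof.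
move=> mH H0 Hout; rewrite /walk_sum.
have [mZ indZ] := walk_state_spec n.
have mU : measurable_fun setT (U n) by exact: (unif_measurable unifU).
have mX : measurable_fun setT (increment n) by exact: measurable_increment.
have nU : ~ before n (true, n) by rewrite /before /= ltnn.
have nX : ~ (before n `|` [set (true, n)]) (false, n).
  by rewrite /before /= => -[|//]; rewrite ltnn.
have indZU := indep_of_next_pair driver_events_measurable indep_driver mZ mU nU
  measurableT (@driver_events_preimage (true, n)) indZ.
have mZU : measurable_fun setT (fun w => (walk_state n w, U n w)).
  exact: measurable_fun_pair.
(* The weight is nonnegative along the walk but not at every y; the absolute value makes G
   nonnegative everywhere, as Tonelli requires. *)
pose G y := H (walk_push y).1 * `|(walk_push y).2|%:E : \bar R.
have G0 y : 0 <= G y by rewrite mule_ge0// lee_fin.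
have mG : measurable_fun setT G.
  have mp := @measurable_walk_push n.
  apply: emeasurable_funM.
    apply: (measurableT_comp mH).
    exact: (measurableT_comp measurable_fst mp).
  apply/measurable_EFinP; apply: measurableT_comp => //.
  exact: (measurableT_comp measurable_snd mp).
transitivity (\int[Q]_(w in setT) G (walk_state n w, U n w, increment n w)).
  apply: eq_integral => w _; rewrite /G -walk_stateS ger0_norm//.
  exact: walk_weight_ge0.
rewrite (ge0_integral_indep_next indep_driver mZU mX nX measurableT
  (@driver_events_preimage (false, n)) indZU)//.
pose G2 y := \int[Q]_w G (y, increment n w).
have mG2 : measurable_fun setT G2.
  pose f (t : (wstate n * R) * Omega) := G (t.1, increment n t.2).
  apply: (measurable_fun_fubini_tonelli_F (m2 := Q) f).
    apply: (measurableT_comp mG); apply: measurable_fun_pair => //.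
    exact: measurableT_comp.
  by move=> t; exact: G0.
have G20 y : 0 <= G2 y by exact: integral_ge0.
rewrite -/(G2 _) (ge0_integral_indep_next indep_driver mZ mU nU measurableT
  (@driver_events_preimage (true, n)) indZ (g := G2))//.
apply: eq_integral => w _.
rewrite (@integral_uniform_law _ (fun u => G2 (walk_state n w, u)))//;
  last first.
  exact: (measurable_fun_pair2 (walk_state n w) mG2).
rewrite -integral_walk_push//.
- apply: eq_integral => u; rewrite inE /= in_itv /= => /andP[u0 u1].
  rewrite /G2 (@integral_gamma_law _ (fun x => G (walk_state n w, u, x)))//.
    apply: eq_integral => x _; rewrite /G ger0_norm//.
    rewrite /walk_push /= mulr_ge0 ?walk_weight_ge0// mulr_ge0 ?expR_ge0//.
    by rewrite subKr uprod_ge0.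
  exact: (measurable_fun_pair2 (walk_state n w, u) mG).
- by rewrite /= lerBlDr lerDl uprod_ge0.
- exact: walk_weight_ge0.
Qed.

End walk.

(** * The many-to-one formula *)

Section strip.
Variable R : realType.

Lemma measurable_unit_strip : measurable (@unit_strip R).
Proof.
pose b (z : R * R) := (0 <= z.1) && (z.1 <= 1) && (0 <= z.2).
have mb : measurable_fun setT b.
  by apply: measurable_and; [apply: measurable_and|]; apply: measurable_fun_ler.
have -> : @unit_strip R = b @^-1` [set true].
  apply/seteqP; split => z; rewrite /unit_strip /b /=.
    by move=> [-> ->].
  by move=> /andP[-> ->].
by rewrite -[X in measurable X]setTI; exact: mb.
Qed.

Lemma measurable_unit_strip_pow n : measurable (@unit_strip_pow R n).
Proof.
have -> : @unit_strip_pow R n =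
    \bigcap_(i in [set: 'I_n]) (@tnth n (R * R) ^~ i) @^-1` @unit_strip R.
  by apply/seteqP; split => [p pS i _|p pS i]; exact: pS.
apply: fin_bigcap_measurable => // i _; rewrite -[X in measurable X]setTI.
by apply: measurable_tnth => //; exact: measurable_unit_strip.
Qed.

Definition flip n (t : n.-tuple (R * R)) : n.-tuple (R * R) :=
  [tuple (1 - (tnth t i).1, (tnth t i).2) | i < n].

Lemma measurable_flip n : measurable_fun setT (@flip n).
Proof.
apply/measurable_fun_tnthP => i.
rewrite (_ : _ \o _ =
    fun t : n.-tuple (R * R) => (1 - (tnth t i).1, (tnth t i).2)).
  have mi := @measurable_tnth _ (R * R)%type n i.
  apply: measurable_fun_pair.
    apply: measurable_funB => //.
    exact: (measurableT_comp measurable_fst mi).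
  exact: (measurableT_comp measurable_snd mi).
by apply/funext => t; rewrite /flip /= tnth_mktuple.
Qed.

End strip.

Section ancestors.
Context {R : realType} {d : measure_display} {Omega : measurableType d}.
Variables (N : word -> nat -> Omega -> R * pstar R) (w : Omega).
Hypothesis N_gt0 : forall u j, 0 < (N u j w).1.

(** Displacements are nonnegative, so an atom in the strip has its whole ancestral line there, and f
    is evaluated where it is assumed measurable and nonnegative. *)
Lemma ancestor_position_le u m : is_atom N w u ->
  [/\ 0 <= (position N w (drop m u)).1,
      (position N w (drop m u)).1 <= (position N w u).1,
      0 <= (position N w (drop m u)).2 &
      (position N w (drop m u)).2 <= (position N w u).2].
Proof.
elim: u m => [|[j k] v IH] m //= /andP[vA _].
have t0 : 0 <= (N v j w).1 by exact/ltW.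
have x0 : 0 <= fine (pstar_val (N v j w).2 k).
  by apply: fine_ge0; apply: ltW; exact: pstar_gt0.
have [] := IH 0%N vA; rewrite drop0 => p0 _ q0 _.
case: m => [|m] /=; first by split => //; rewrite addr_ge0.
have [r0 rp s0 sq] := IH m vA.
by split => //; [apply: le_trans rp _|apply: le_trans sq _]; rewrite /= lerDl.
Qed.

End ancestors.

Theorem proposition4p1 (R : realType) (alpha : R)
    (lam : {finite_measure set (pstar R) -> \bar R})
    (Lam : {measure set (pstar R) -> \bar R})
    (d : measure_display) (Omega : measurableType d) (P : probability Omega R)
    (N : word -> nat -> Omega -> R * pstar R)
    (d' : measure_display) (Omega' : measurableType d')
    (Q : probability Omega' R) (S U : nat -> Omega' -> R) :
  0 < alpha ->
  lam setT <> 0%E ->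
  (c_lambda alpha lam < +oo)%E ->
  (c_lambda alpha lam * (Gamma alpha)%:E = 1)%E ->
  is_Lambda_star alpha lam Lam ->
  is_brw P Lam N ->
  is_gamma_walk Q alpha S ->
  is_iid_uniform Q U ->
  indep_seqs Q S U ->
  forall (n : nat) (f : n.-tuple (R * R) -> R),
    (1 <= n)%N ->
    measurable_fun (@unit_strip_pow R n) f ->
    (forall p, unit_strip_pow p -> 0 <= f p) ->
    (\int[P]_w
       (\esum_(u in generation N n w `&` [set u | unit_strip (position N w u)])
          (f [tuple (1 - (ancestor N w u i.+1).1, (ancestor N w u i.+1).2)%R
                | i < n])%:E) =
     \int[Q]_w
       (f [tuple (uprod U i.+1 w, S i.+1 w) | i < n]
        * expR (S n w) * \prod_(1 <= i < n) uprod U i w)%:E)%E.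
Proof.
move=> _ _ c_fin c_norm LamE brwN walkS unifU indSU n f n0 mf f0.
have G0 := Gamma_inv_ge0 c_fin c_norm.
have sumE m (H : (R * R) * m.-tuple (R * R) -> \bar R) :
    measurable_fun setT H -> (forall z, 0 <= H z)%E ->
    (forall z, (1 < z.1.1)%R -> H z = 0%E) ->
    generation_sum P N H = walk_sum Q S U H.
  elim: m H => [|m IH] H mH H0 Hout.
    rewrite /generation_sum /walk_sum.
    have -> : [set u : word | size u = 0%N] = [set [::]].
      by apply/seteqP; split => [u /= /size0nil|u ->].
    rewrite esum_set1; last by exact: integral_ge0.
    have -> : atoms N [::] = setT by apply/seteqP; split.
    transitivity (H ((0, 0), [tuple])).
      rewrite (eq_integral (cst (H ((0, 0), [tuple])))); last first.
        by move=> w _; rewrite /state /=; congr (H (_, _)); exact: tuple0.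
      by rewrite integral_cst//= probability_setT mule1.
    rewrite (eq_integral (cst (H ((0, 0), [tuple])))); last first.
      move=> w _; rewrite /walk_state /walk_weight /= /uprod !big_ord0.
      rewrite (walk0 walkS) expR0 mulr1 subrr mule1; congr (H (_, _)).
      exact: tuple0.
    by rewrite integral_cst//= probability_setT mule1.
  rewrite (generation_sumS LamE c_fin c_norm brwN mH H0).
  rewrite (walk_sumS G0 walkS unifU indSU mH H0 Hout); apply: IH.
  - exact: (measurable_kernel G0 mH H0).
  - by move=> z; exact: (kernel_ge0 G0 z H0).
  (* Vanishing after time 1 is inherited: [rate] is 0 unless s > 0, so a time beyond 1 stays beyond
     1. *)
  - move=> z z1; rewrite /kernel integral0_eq// => s _.
    rewrite integral0_eq// => x _; rewrite /rate indicE mem_itv0y.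
    case: ltP => s0; last by rewrite mul0r mul0e.
    by rewrite Hout ?mule0//= (lt_trans z1)// ltrDl.
(* The hypotheses on f concern the strip only, hence the extension by 0. *)
pose ft := f \_ (@unit_strip_pow R n).
have mft : measurable_fun setT ft.
  have mD := @measurable_unit_strip_pow R n.
  exact: ((measurable_restrictT f mD).1 mf).
have ft0 p : 0 <= ft p.
  by rewrite /ft patchE; case: ifP => // /set_mem /f0.
(* The test on the current time encodes the restriction to t <= 1 and makes H vanish after time 1;
   [flip] restores the complements 1 - t that f expects. *)
pose H (z : (R * R) * n.-tuple (R * R)) : \bar R :=
  if z.1.1 <= 1 then (ft (flip z.2))%:E else 0%E.
have H0 z : (0 <= H z)%E by rewrite /H; case: ifP; rewrite ?lee_fin.
have mH : measurable_fun setT H.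
  apply: measurable_fun_ifT => //.
    by apply: measurable_fun_ler => //; exact: measurableT_comp.
  apply/measurable_EFinP; apply: (measurableT_comp mft).
  exact: (measurableT_comp (@measurable_flip R n) measurable_snd).
have Hout z : (1 < z.1.1)%R -> H z = 0%E by rewrite /H ltNge => /negbTE ->.
transitivity (generation_sum P N H).
  rewrite /generation_sum.
  under [RHS]eq_esum do rewrite integral_mkcond.
  rewrite -integral_esum_countable; last 2 first.
  - move=> u un; have [mX mA _] := state_spec brwN un.
    apply/(measurable_restrictT _ mA).1; apply: measurable_funTS.
    exact: (measurableT_comp mH mX).
  - by move=> u w _; rewrite patchE; case: ifP.
  apply: eq_integral => w _; rewrite esum_mkcond [RHS]esum_mkcond.
  apply: eq_esum => u _; rewrite in_setI patchE.
  have [un|un] := eqVneq (size u) n; last first.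
    rewrite memNset; last by move=> [] /eqP; rewrite (negbTE un).
    by rewrite [RHS]ifF// memNset//= => /eqP; rewrite (negbTE un).
  rewrite [RHS]ifT; last by apply/mem_set.
  have [uA|uA] := boolP (is_atom N w u); last first.
    rewrite memNset; last by move=> []; rewrite (negbTE uA).
    by rewrite [RHS]ifF// memNset//=; exact/negP.
  rewrite [RHS]ifT; last by apply/mem_set.
  rewrite mem_set//=; rewrite /H /=.
  have N_gt0 v j := brw_time_gt0 brwN v j w.
  have pos m := ancestor_position_le N_gt0 m uA.
  have [p0 _ q0 _] := pos 0%N; rewrite drop0 in p0 q0.
  (* Atoms have nonnegative coordinates, so lying in the strip amounts to t <= 1, the test made by
     H. *)
  case: ifPn => [/set_mem [/= /andP[_ p1] _]|/negP out]; last first.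
    by rewrite ifF//; apply/negP => p1; apply/out/mem_set; split => //=;
      rewrite p0.
  rewrite p1; congr (_%:E).
  have -> : flip (state N n w u).2 =
      [tuple (1 - (ancestor N w u i.+1).1, (ancestor N w u i.+1).2) | i < n].
    by apply: eq_from_tnth => i; rewrite !tnth_mktuple.
  rewrite /ft patchE mem_set// => i; rewrite tnth_mktuple /unit_strip /=.
  have [r0 rp s0 _] := pos (size u - i.+1)%N.
  by split => //; rewrite subr_ge0 (le_trans rp p1) gerBl.
rewrite sumE//; apply: eq_integral => w _; rewrite /H /=.
rewrite lerBlDr lerDl (uprod_ge0 unifU)// -EFinM; congr (_%:E).
have -> : flip (walk_state S U n w).1.2 =
    [tuple (uprod U i.+1 w, S i.+1 w) | i < n].
  by apply: eq_from_tnth => i; rewrite !tnth_mktuple /= subKr.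
rewrite /ft patchE mem_set; last first.
  move=> i; rewrite tnth_mktuple /unit_strip /= (walk_ge0 walkS).
  rewrite (uprod_ge0 unifU)//.
  split => //; apply: prodr_ile1 => j _; exact: (unif_itv unifU).
rewrite -mulrA; congr (_ * _); rewrite /walk_weight; congr (_ * _).
(* Since n >= 1, the factor A_0 = 1 can be split off the weight. *)
rewrite -(big_mkord xpredT (fun i => uprod U i w)) big_ltn//.
by rewrite {1}/uprod big_ord0 mul1r.
Qed.
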